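(* Let $A=U\ltimes H\rtimes G$ with $U=u_q\mathfrak{sl}_2$, $H=\mathrm{SF}_{2p}$, $G=\mathbb K[S_p]$, with the quasitriangular structure $R=R_{\mathsf z}D\Theta\bar R_{\boldsymbol\alpha}$ described in the context. There is an embedding of symmetric categories $I:\mathbb K[S_p]\text{-mod}\to\mathcal Z_{(2)}(A\text{-mod})$. In particular, $\mathcal Z_{(2)}(A\text{-mod})$ is a non-semisimple symmetric category.
   Context: $p>2$ is a prime, $\mathbb K$ an algebraically closed field of characteristic $p$, $q\in\mathbb K$ a primitive $r$-th root of unity with $r$ divisible by $8$ and coprime to $p$; $r'=r/2$, $r''=r/4$, $\{k\}=q^k-q^{-k}$, $[k]=\{k\}/\{1\}$, $[k]!=[k]\cdots[1]$. The algebra $A$: generated over $\mathbb K$ by $K,E,F$, $L$, $Z_l^{\pm}$ ($1\le l\le p$) and the elements $\sigma\in S_p$, with relations: $K^{r'}=1$, $E^{r'}=F^{r'}=0$, $KEK^{-1}=q^2E$, $KFK^{-1}=q^{-2}F$, $[E,F]=\frac{K-K^{-1}}{q-q^{-1}}$; $L^2=1$, $LZ_l^\pm=-Z_l^\pm L$, all $Z_l^{\pm}$ square to zero and pairwise anticommute; $L$ commutes with $K,E,F$; $KZ_l^\pm=-Z_l^\pm K$, $EZ_l^\pm=-Z_l^\pm E$, $FZ_l^\pm=Z_l^\pm F$; elements of $S_p$ multiply as in $S_p$, commute with $E,F,K,L$, and $\sigma Z_l^\pm=Z^\pm_{\sigma(l)}\sigma$. Put $\bar L=K^{r''}L$. Hopf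 structure: $K,L,\sigma$ grouplike; $\Delta(E)=1\otimes E+E\otimes K$, $\Delta(F)=F\otimes1+K^{-1}\otimes F$, $\Delta(Z_l^\pm)=1\otimes Z_l^\pm+Z_l^\pm\otimes\bar L$; $\epsilon(E)=\epsilon(F)=\epsilon(Z_l^\pm)=0$; $S(E)=-EK^{-1}$, $S(F)=-KF$, $S(Z_l^\pm)=-Z_l^\pm\bar L$. R-matrix: $R=R_{\mathsf z}D\Theta\bar R_{\boldsymbol\alpha}$, $R_{\mathsf z}=\frac12\sum_{v,w\in\{0,1\}}(-1)^{vw}L^w\otimes L^v$, $D=\frac1{r'}\sum_{b,c=0}^{r'-1}q^{-2bc}K^b\otimes K^c$, $\Theta=\sum_{a=0}^{r'-1}\frac{\{1\}^a}{[a]!}q^{a(a-1)/2}E^a\otimes F^a$, $\bar R_{\boldsymbol\alpha}=\exp\big(\sum_{l=1}^p\alpha_l(Z_l^+\otimes\bar LZ_l^--Z_l^-\otimes\bar LZ_l^+)\big)$ (the exponential is formal, enumerating all products of the commuting square-zero summands), where the tuple $\boldsymbol\alpha=(\alpha_1,\dots,\alpha_p)$ has only non-zero entries in $\mathbb K$. $A$-mod is the braided category of finite-dimensional left $A$-modules, with braiding $v\otimes w\mapsto R''w\otimes R'v$; its Müger centre $\mathcal Z_{(2)}(A\text{-mod})$ is the full subcategory of those $V$ whose double braiding with every module is the identity. $\mathbb K[S_p]$-mod carries the flip as symmetric braiding. An embedding of symmetric categories is a fully faithful braided monoidal functor. *)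

(* Defs.v *)
Set Warnings "-notation-overridden,-ambiguous-paths".
From HB Require Import structures.
From mathcomp Require Import all_boot all_order all_algebra all_fingroup finmap.
From mathcomp.multinomials Require Import monalg.

Set Implicit Arguments.
Unset Strict Implicit.
Unset Printing Implicit Defensive.

Import GRing.Theory.
Local Open Scope ring_scope.

(* Objects and morphisms are the elements of [ob] and [hom X Y] that satisfy
   [is_ob] and [is_hom].  Keeping these predicates apart from the types lets
   the tensor product and the braiding be given by plain formulas; that they
   preserve [is_ob] and [is_hom] is then part of the laws collected in [is_symmetric].
   The Mueger centre needs only the formula for the double braiding. *)
Record bmcat := BMCat {
  ob : Type;
  hom : ob -> ob -> zmodType;
  is_ob : ob -> Prop;
  is_hom : forall X Y, hom X Y -> Prop;
  idm : forall X, hom X X;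
  comp : forall X Y Z, hom Y Z -> hom X Y -> hom X Z;
  one : ob;
  tens : ob -> ob -> ob;
  tensm : forall X X' Y Y',
    hom X X' -> hom Y Y' -> hom (tens X Y) (tens X' Y');
  assoc : forall X Y Z, hom (tens (tens X Y) Z) (tens X (tens Y Z));
  associ : forall X Y Z, hom (tens X (tens Y Z)) (tens (tens X Y) Z);
  lunit : forall X, hom (tens one X) X;
  runit : forall X, hom (tens X one) X;
  braid : forall X Y, hom (tens X Y) (tens Y X)
}.

Arguments hom : clear implicits.
Arguments idm {b} X.
Arguments one b : clear implicits.
Arguments tens {b} X Y.
Arguments assoc {b} X Y Z.
Arguments associ {b} X Y Z.
Arguments lunit {b} X.
Arguments runit {b} X.
Arguments braid {b} X Y.

Declare Scope bmcat_scope.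
Delimit Scope bmcat_scope with bm.
Notation "g ∘ f" := (comp g f) (at level 40, left associativity) : bmcat_scope.
Notation "X ⊗ Y" := (tens X Y) (at level 39, left associativity) : bmcat_scope.
Notation "f ⊠ g" := (tensm f g) (at level 39, left associativity) : bmcat_scope.
Local Open Scope bmcat_scope.

Section Laws.
Variable C : bmcat.

Definition is_iso (X Y : ob C) (f : hom C X Y) : Prop :=
  is_hom f /\
  exists g : hom C Y X, [/\ is_hom g, g ∘ f = idm X & f ∘ g = idm Y].

Record is_category : Prop := IsCategory {
  idm_hom : forall X : ob C, is_ob X -> is_hom (idm X);
  comp_hom : forall (X Y Z : ob C) (g : hom C Y Z) (f : hom C X Y),
    is_ob X -> is_ob Y -> is_ob Z -> is_hom g -> is_hom f -> is_hom (g ∘ f);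
  zero_hom : forall X Y : ob C, is_ob X -> is_ob Y -> is_hom (0 : hom C X Y);
  sub_hom : forall (X Y : ob C) (f g : hom C X Y),
    is_ob X -> is_ob Y -> is_hom f -> is_hom g -> is_hom (f - g);
  compA : forall (W X Y Z : ob C)
      (h : hom C Y Z) (g : hom C X Y) (f : hom C W X),
    is_ob W -> is_ob X -> is_ob Y -> is_ob Z ->
    is_hom h -> is_hom g -> is_hom f -> h ∘ (g ∘ f) = h ∘ g ∘ f;
  comp1m : forall (X Y : ob C) (f : hom C X Y),
    is_ob X -> is_ob Y -> is_hom f -> idm Y ∘ f = f;
  compm1 : forall (X Y : ob C) (f : hom C X Y),
    is_ob X -> is_ob Y -> is_hom f -> f ∘ idm X = f;
  compDl : forall (X Y Z : ob C) (g g' : hom C Y Z) (f : hom C X Y),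
    is_ob X -> is_ob Y -> is_ob Z -> is_hom g -> is_hom g' -> is_hom f ->
    (g + g') ∘ f = g ∘ f + g' ∘ f;
  compDr : forall (X Y Z : ob C) (g : hom C Y Z) (f f' : hom C X Y),
    is_ob X -> is_ob Y -> is_ob Z -> is_hom g -> is_hom f -> is_hom f' ->
    g ∘ (f + f') = g ∘ f + g ∘ f'
}.

Record is_monoidal : Prop := IsMonoidal {
  monoidal_category : is_category;
  one_ob : is_ob (one C);
  tens_ob : forall X Y : ob C, is_ob X -> is_ob Y -> is_ob (X ⊗ Y);
  tensm_hom : forall (X X' Y Y' : ob C) (f : hom C X X') (g : hom C Y Y'),
    is_ob X -> is_ob X' -> is_ob Y -> is_ob Y' ->
    is_hom f -> is_hom g -> is_hom (f ⊠ g);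
  tensm1 : forall X Y : ob C, is_ob X -> is_ob Y ->
    idm X ⊠ idm Y = idm (X ⊗ Y);
  tensm_comp : forall (X X' X'' Y Y' Y'' : ob C)
      (f' : hom C X' X'') (f : hom C X X') (g' : hom C Y' Y'') (g : hom C Y Y'),
    is_ob X -> is_ob X' -> is_ob X'' -> is_ob Y -> is_ob Y' -> is_ob Y'' ->
    is_hom f' -> is_hom f -> is_hom g' -> is_hom g ->
    (f' ∘ f) ⊠ (g' ∘ g) = (f' ⊠ g') ∘ (f ⊠ g);
  assoc_iso : forall X Y Z : ob C, is_ob X -> is_ob Y -> is_ob Z ->
    [/\ is_hom (assoc X Y Z), is_hom (associ X Y Z),
        associ X Y Z ∘ assoc X Y Z = idm (X ⊗ Y ⊗ Z)
      & assoc X Y Z ∘ associ X Y Z = idm (X ⊗ (Y ⊗ Z))];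
  assoc_nat : forall (X X' Y Y' Z Z' : ob C)
      (f : hom C X X') (g : hom C Y Y') (h : hom C Z Z'),
    is_ob X -> is_ob X' -> is_ob Y -> is_ob Y' -> is_ob Z -> is_ob Z' ->
    is_hom f -> is_hom g -> is_hom h ->
    assoc X' Y' Z' ∘ (f ⊠ g ⊠ h) = (f ⊠ (g ⊠ h)) ∘ assoc X Y Z;
  lunit_iso : forall X : ob C, is_ob X -> is_iso (lunit X);
  lunit_nat : forall (X X' : ob C) (f : hom C X X'),
    is_ob X -> is_ob X' -> is_hom f ->
    lunit X' ∘ (idm (one C) ⊠ f) = f ∘ lunit X;
  runit_iso : forall X : ob C, is_ob X -> is_iso (runit X);
  runit_nat : forall (X X' : ob C) (f : hom C X X'),
    is_ob X -> is_ob X' -> is_hom f ->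
    runit X' ∘ (f ⊠ idm (one C)) = f ∘ runit X;
  pentagon : forall W X Y Z : ob C,
    is_ob W -> is_ob X -> is_ob Y -> is_ob Z ->
    (idm W ⊠ assoc X Y Z) ∘ assoc W (X ⊗ Y) Z ∘ (assoc W X Y ⊠ idm Z)
    = assoc W X (Y ⊗ Z) ∘ assoc (W ⊗ X) Y Z;
  triangle : forall X Y : ob C, is_ob X -> is_ob Y ->
    (idm X ⊠ lunit Y) ∘ assoc X (one C) Y = runit X ⊠ idm Y
}.

Record is_braided : Prop := IsBraided {
  braided_monoidal : is_monoidal;
  braid_iso : forall X Y : ob C, is_ob X -> is_ob Y -> is_iso (braid X Y);
  braid_nat : forall (X X' Y Y' : ob C) (f : hom C X X') (g : hom C Y Y'),
    is_ob X -> is_ob X' -> is_ob Y -> is_ob Y' -> is_hom f -> is_hom g ->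
    braid X' Y' ∘ (f ⊠ g) = (g ⊠ f) ∘ braid X Y;
  hexagon : forall X Y Z : ob C, is_ob X -> is_ob Y -> is_ob Z ->
    assoc Y Z X ∘ braid X (Y ⊗ Z) ∘ assoc X Y Z
    = (idm Y ⊠ braid X Z) ∘ assoc Y X Z ∘ (braid X Y ⊠ idm Z);
  hexagon' : forall X Y Z : ob C, is_ob X -> is_ob Y -> is_ob Z ->
    associ Z X Y ∘ braid (X ⊗ Y) Z ∘ associ X Y Z
    = (braid X Z ⊠ idm Y) ∘ associ X Z Y ∘ (idm X ⊠ braid Y Z)
}.

Record is_symmetric : Prop := IsSymmetric {
  symmetric_braided : is_braided;
  braidK : forall X Y : ob C, is_ob X -> is_ob Y ->
    braid Y X ∘ braid X Y = idm (X ⊗ Y)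
}.

Definition zero_ob (X : ob C) : Prop := is_ob X /\ idm X = 0.

Definition mono (X Y : ob C) (f : hom C X Y) : Prop :=
  is_hom f /\
  forall (W : ob C) (g g' : hom C W X),
    is_ob W -> is_hom g -> is_hom g' -> f ∘ g = f ∘ g' -> g = g'.

Definition simple_ob (S : ob C) : Prop :=
  [/\ is_ob S, ~ zero_ob S &
      forall (X : ob C) (f : hom C X S),
        is_ob X -> mono f -> zero_ob X \/ is_iso f].

Definition direct_sum (n : nat) (S : 'I_n -> ob C) (X : ob C) : Prop :=
  exists (inj : forall i, hom C (S i) X) (prj : forall i, hom C X (S i)),
    [/\ forall i, is_hom (inj i) /\ is_hom (prj i),
        forall i, prj i ∘ inj i = idm (S i),
        forall i j, i != j -> prj i ∘ inj j = 0
      & \sum_(i < n) (inj i ∘ prj i) = idm X].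

Definition semisimple : Prop :=
  forall X : ob C, is_ob X ->
    exists (n : nat) (S : 'I_n -> ob C),
      (forall i, simple_ob (S i)) /\ direct_sum S X.

End Laws.

Definition transparent (C : bmcat) (X : ob C) : Prop :=
  forall Y : ob C, is_ob Y -> braid Y X ∘ braid X Y = idm (X ⊗ Y).

Definition muger_centre (C : bmcat) : bmcat :=
  BMCat (fun X : ob C => is_ob X /\ transparent X) (@is_hom C) (@idm C)
    (@comp C) (@tensm C) (@assoc C) (@associ C) (@lunit C) (@runit C)
    (@braid C).

Section Functors.
Variables C D : bmcat.

Record mfunctor := MFunctor {
  fob :> ob C -> ob D;
  fmap : forall X Y, hom C X Y -> hom D (fob X) (fob Y);
  funit : hom D (one D) (fob (one C));
  fmul : forall X Y, hom D (fob X ⊗ fob Y) (fob (X ⊗ Y))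
}.

Variable F : mfunctor.

Record is_functor : Prop := IsFunctor {
  fob_ob : forall X : ob C, is_ob X -> is_ob (F X);
  fmap_hom : forall (X Y : ob C) (f : hom C X Y),
    is_ob X -> is_ob Y -> is_hom f -> is_hom (fmap F f);
  fmap1 : forall X : ob C, is_ob X -> fmap F (idm X) = idm (F X);
  fmap_comp : forall (X Y Z : ob C) (g : hom C Y Z) (f : hom C X Y),
    is_ob X -> is_ob Y -> is_ob Z -> is_hom g -> is_hom f ->
    fmap F (g ∘ f) = fmap F g ∘ fmap F f
}.

Definition fully_faithful : Prop :=
  forall X Y : ob C, is_ob X -> is_ob Y ->
    (forall f f' : hom C X Y, is_hom f -> is_hom f' ->
       fmap F f = fmap F f' -> f = f') /\
    (forall g : hom D (F X) (F Y), is_hom g ->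
       exists2 f : hom C X Y, is_hom f & fmap F f = g).

Record is_monoidal_functor : Prop := IsMonoidalFunctor {
  monoidal_functor : is_functor;
  funit_iso : is_iso (funit F);
  fmul_iso : forall X Y : ob C, is_ob X -> is_ob Y -> is_iso (fmul F X Y);
  fmul_nat : forall (X X' Y Y' : ob C) (f : hom C X X') (g : hom C Y Y'),
    is_ob X -> is_ob X' -> is_ob Y -> is_ob Y' -> is_hom f -> is_hom g ->
    fmul F X' Y' ∘ (fmap F f ⊠ fmap F g) = fmap F (f ⊠ g) ∘ fmul F X Y;
  fmul_assoc : forall X Y Z : ob C, is_ob X -> is_ob Y -> is_ob Z ->
    fmul F X (Y ⊗ Z) ∘ (idm (F X) ⊠ fmul F Y Z) ∘ assoc (F X) (F Y) (F Z)
    = fmap F (assoc X Y Z) ∘ fmul F (X ⊗ Y) Z ∘ (fmul F X Y ⊠ idm (F Z));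
  fmul_lunit : forall X : ob C, is_ob X ->
    fmap F (lunit X) ∘ fmul F (one C) X ∘ (funit F ⊠ idm (F X))
    = lunit (F X);
  fmul_runit : forall X : ob C, is_ob X ->
    fmap F (runit X) ∘ fmul F X (one C) ∘ (idm (F X) ⊠ funit F)
    = runit (F X)
}.

Record is_braided_functor : Prop := IsBraidedFunctor {
  braided_monoidal_functor : is_monoidal_functor;
  fmul_braid : forall X Y : ob C, is_ob X -> is_ob Y ->
    fmul F Y X ∘ braid (F X) (F Y) = fmap F (braid X Y) ∘ fmul F X Y
}.

Definition symmetric_embedding : Prop :=
  [/\ is_symmetric C, is_symmetric D, is_braided_functor & fully_faithful].

End Functors.

Section TensorProduct.
Variable k : fieldType.
Implicit Types U V W : vectType k.

Definition tprod U V : vectType k := 'M[k]_(\dim {:U}, \dim {:V}).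

Definition tpure U V (u : U) (v : V) : tprod U V :=
  \matrix_(i, j) (coord (vbasis {:U}) i u * coord (vbasis {:V}) j v).

(* the linear map that a bilinear [b] induces on the tensor product *)
Definition tlift U V W (b : U -> V -> W) : 'Hom(tprod U V, W) :=
  linfun (fun t : tprod U V =>
    \sum_i \sum_j (t : 'M[k]_(_, _)) i j *: b (vbasis {:U})`_i (vbasis {:V})`_j).

Lemma tliftE U V W (b : U -> V -> W) (u : U) (v : V) :
  (forall v, linear (b^~ v)) -> (forall u, linear (b u)) ->
  tlift b (tpure u v) = b u v.
Proof.
move=> b_lin_l b_lin_r.
pose phi (t : tprod U V) : W :=
  \sum_i \sum_j (t : 'M[k]_(_, _)) i j *: b (vbasis {:U})`_i (vbasis {:V})`_j.
have phi_lin : linear phi.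
  move=> c s t; rewrite scaler_sumr -big_split; apply: eq_bigr => i _ /=.
  rewrite scaler_sumr -big_split; apply: eq_bigr => j _ /=.
  by rewrite !mxE scalerDl scalerA.
pose bl v := GRing.isLinear.Build k U W _ (b^~ v) (b_lin_l v).
pose br u := GRing.isLinear.Build k V W _ (b u) (b_lin_r u).
pose phim := GRing.isLinear.Build k _ W _ phi phi_lin.
pose phil : {linear tprod U V -> W} := HB.pack phi phim.
rewrite /tlift -[linfun _]/(linfun phil) lfunE /= /phi.
pose bU v : {linear U -> W} := HB.pack (b^~ v) (bl v).
pose bV u : {linear V -> W} := HB.pack (b u) (br u).
rewrite [in RHS](coord_vbasis (memvf u)) -[RHS]/(bU v _) linear_sum /=.
apply: eq_bigr => i _; rewrite -[b _ v]/(bU v _) linearZ /=.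
rewrite [in RHS](coord_vbasis (memvf v)) -[b _ _ in RHS]/(bV _ _) linear_sum.
rewrite scaler_sumr; apply: eq_bigr => j _.
by rewrite mxE linearZ /= scalerA.
Qed.

Definition tmap U U' V V' (f : 'Hom(U, U')) (g : 'Hom(V, V')) :
    'Hom(tprod U V, tprod U' V') :=
  tlift (fun u v => tpure (f u) (g v)).

Definition tassoc U V W : 'Hom(tprod (tprod U V) W, tprod U (tprod V W)) :=
  tlift (fun t w => tlift (fun u v => tpure u (tpure v w)) t).

Definition tassoci U V W : 'Hom(tprod U (tprod V W), tprod (tprod U V) W) :=
  tlift (fun u t => tlift (fun v w => tpure (tpure u v) w) t).

Definition tlunit V : 'Hom(tprod k^o V, V) := tlift (fun (c : k^o) v => c *: v).

Definition trunit V : 'Hom(tprod V k^o, V) := tlift (fun v (c : k^o) => c *: v).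

Definition tflip U V : 'Hom(tprod U V, tprod V U) :=
  tlift (fun u v => tpure v u).

End TensorProduct.

Section Presentations.
Variable k : fieldType.

Definition free_alg (X : choiceType) := {malg k[{fmonom X}]}.

Definition var (X : choiceType) (x : X) : free_alg X := << fmu x >>.

Definition subst (X Y : choiceType) (h : X -> free_alg Y) (a : free_alg X) :
    free_alg Y :=
  mmap (@malgC {fmonom Y} k) (fun m : {fmonom X} => \prod_(x <- m) h x) a.

(* An element of the tensor square of the algebra generated by [X] is written
   as a noncommutative polynomial in two copies of [X]: [inl x] stands for
   x ⊗ 1 and [inr x] for 1 ⊗ x. *)
Definition free_alg2 (X : choiceType) := free_alg (X + X)%type.

Definition pure2 (X : choiceType) (a b : free_alg X) : free_alg2 X :=
  subst (fun x => var (inl x)) a * subst (fun x => var (inr x)) b.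

(* The algebra is the quotient of [free_alg gen] by [relation]; a module over it
   is a space with operators for the generators that satisfy the relations.
   An antipode is not needed to form the monoidal category of modules and its
   braiding. *)
Record presentation := Presentation {
  gen : choiceType;
  relation : free_alg gen -> free_alg gen -> Prop;
  coprod : gen -> free_alg2 gen;
  counit : gen -> k;
  Rmat : free_alg2 gen
}.

Definition eval (X : choiceType) (V : vectType k) (rho : X -> 'End(V))
    (a : free_alg X) : 'End(V) :=
  \sum_(m <- msupp a)
     a@_m *: \big[@comp_lfun k V V V / \1%VF]_(x <- m) rho x.

(* [eval rho] is the algebra morphism from the free algebra to End(V) that
   extends [rho] *)
Section EvalTheory.
Variables (X : choiceType) (V : vectType k) (rho : X -> 'End(V)).
Local Notation ev := (eval rho).
Local Notation evm m :=
  (\big[@comp_lfun k V V V / \1%VF]_(x <- fmonom_val m) rho x).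

Lemma evalEw (d : {fset {fmonom X}}) (a : free_alg X) :
  (msupp a `<=` d)%fset -> ev a = \sum_(m <- d) a@_m *: evm m.
Proof.
move=> le_ad; rewrite /eval (big_fset_incl _ le_ad) // => m _ /mcoeff_outdom ->.
by rewrite scale0r.
Qed.

Lemma evalD a b : ev (a + b) = ev a + ev b.
Proof.
rewrite (evalEw (msuppD_le a b)) (evalEw (fsubsetUl (msupp a) (msupp b))).
rewrite (evalEw (fsubsetUr (msupp a) (msupp b))) -big_split /=.
by apply: eq_bigr => m _; rewrite mcoeffD scalerDl.
Qed.

Lemma evalZ c a : ev (c *: a) = c *: ev a.
Proof.
rewrite (evalEw (msuppZ_le c a)) /eval scaler_sumr.
by apply: eq_bigr => m _; rewrite mcoeffZ scalerA.
Qed.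

Lemma evalU c m : ev << c *g m >> = c *: evm m.
Proof. by rewrite (evalEw (msuppU_le (k := m) (x := c))) big_seq_fset1 mcoeffUU. Qed.

Lemma eval1 : ev 1 = \1%VF.
Proof. by rewrite evalU fm1 big_nil scale1r. Qed.

Lemma eval_var x : ev (var x) = rho x.
Proof. by rewrite evalU fmU big_cons big_nil scale1r comp_lfun1r. Qed.

Lemma eval_sum (I : Type) (s : seq I) (P : pred I) (G : I -> free_alg X) :
  ev (\sum_(i <- s | P i) G i) = \sum_(i <- s | P i) ev (G i).
Proof.
apply: (big_morph ev evalD).
by rewrite -(scale0r (0 : free_alg X)) evalZ scale0r.
Qed.

Lemma evalM a b : ev (a * b) = (ev a \o ev b)%VF.
Proof.
rewrite malgME eval_sum.
have suml (I : Type) (s : seq I) (G : I -> 'End(V)) (h : 'End(V)) :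
    ((\sum_(i <- s) G i) \o h = \sum_(i <- s) (G i \o h))%VF.
  apply: (big_morph (fun f => f \o h)%VF); last exact: comp_lfun0l.
  by move=> f g; exact: comp_lfunDl.
have sumr (I : Type) (s : seq I) (G : I -> 'End(V)) (h : 'End(V)) :
    (h \o (\sum_(i <- s) G i) = \sum_(i <- s) (h \o G i))%VF.
  apply: (big_morph (fun f => h \o f)%VF); last exact: comp_lfun0r.
  by move=> f g; exact: comp_lfunDr.
rewrite [X in (X \o _)%VF]/eval suml; apply: eq_bigr => m _.
rewrite eval_sum [X in (_ \o X)%VF]/eval sumr; apply: eq_bigr => n _.
rewrite evalU -comp_lfunZl -comp_lfunZr scalerA fmM.
congr (_ *: _); elim: (m : seq X) => [|x s IHs] /=.
  by rewrite big_nil comp_lfun1l.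
by rewrite !big_cons IHs comp_lfunA.
Qed.

End EvalTheory.

Variable A : presentation.

Record rep := Rep {
  space : vectType k;
  act : gen A -> 'End(space)
}.

Definition is_module (V : rep) : Prop :=
  forall a b, relation a b -> eval (@act V) a = eval (@act V) b.

Definition is_module_hom (V W : rep) (f : 'Hom(space V, space W)) : Prop :=
  forall x : gen A, (f \o act V x = act W x \o f)%VF.

Definition act2 (V W : rep) (x : gen A + gen A) :
    'End(tprod (space V) (space W)) :=
  match x with
  | inl x => tmap (act V x) \1%VF
  | inr x => tmap \1%VF (act W x)
  end.

Definition rep_one : rep :=
  @Rep k^o (fun x => counit x *: \1%VF).

Definition rep_tens (V W : rep) : rep :=
  @Rep (tprod (space V) (space W)) (fun x => eval (act2 V W) (coprod x)).

(* v ⊗ w |-> R'' w ⊗ R' v *)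
Definition rep_braid (V W : rep) :
    'Hom(tprod (space V) (space W), tprod (space W) (space V)) :=
  (tflip (space V) (space W) \o eval (act2 V W) (Rmat A))%VF.

Definition modcat : bmcat := @BMCat rep
  (fun V W => 'Hom(space V, space W)) is_module is_module_hom
  (fun V => \1%VF) (fun U V W g f => (g \o f)%VF)
  rep_one rep_tens (fun V V' W W' f g => tmap f g)
  (fun U V W => tassoc (space U) (space V) (space W))
  (fun U V W => tassoci (space U) (space V) (space W))
  (fun V => tlunit (space V)) (fun V => trunit (space V))
  rep_braid.

End Presentations.

(* Permutations are composed from right to left, as maps, whereas [(s * t)%g]
   is [s] followed by [t]. *)

Section SymmetricGroup.
Variables (k : fieldType) (p : nat).

Local Notation S s := (var k (s : 'S_p)).

Inductive Sp_rel : free_alg k 'S_p -> free_alg k 'S_p -> Prop :=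
| Sp_one : Sp_rel (S 1%g) 1
| Sp_mul s t : Sp_rel (S s * S t) (S (t * s)%g).

Definition Sp_alg : presentation k :=
  @Presentation k 'S_p Sp_rel (fun s => pure2 (S s) (S s)) (fun=> 1) 1.

End SymmetricGroup.

Inductive A_gen (p : nat) : predArgType :=
  gK | gE | gF | gL | gZ of bool & 'I_p | gS of 'S_p.

Arguments gK {p}.
Arguments gE {p}.
Arguments gF {p}.
Arguments gL {p}.

Section AGenChoice.
Variable p : nat.

Definition A_gen_code (x : A_gen p) : ('I_4 + (bool * 'I_p) + 'S_p)%type :=
  match x with
  | gK => inl (inl (inord 0)) | gE => inl (inl (inord 1))
  | gF => inl (inl (inord 2)) | gL => inl (inl (inord 3))
  | gZ e l => inl (inr (e, l)) | gS s => inr s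
  end.

Definition A_gen_decode (c : ('I_4 + (bool * 'I_p) + 'S_p)%type) : A_gen p :=
  match c with
  | inl (inl i) => nth gK [:: gK; gE; gF; gL] i
  | inl (inr (e, l)) => gZ e l
  | inr s => gS s
  end.

Lemma A_gen_codeK : cancel A_gen_code A_gen_decode.
Proof. by case=> //=; rewrite ?inordK. Qed.

HB.instance Definition _ := Choice.copy (A_gen p) (can_type A_gen_codeK).

End AGenChoice.

Section AlgebraA.
Variables (k : fieldType) (p r : nat) (q : k) (alpha : 'I_p -> k).

Local Notation r' := (r %/ 2)%N.
Local Notation r'' := (r %/ 4)%N.

Definition qbrace (n : nat) : k := q ^+ n - q ^- n.
Definition qint (n : nat) : k := qbrace n / qbrace 1.
Definition qfact (n : nat) : k := \prod_(1 <= i < n.+1) qint i.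

Local Notation K := (var k gK).
Local Notation E := (var k gE).
Local Notation F := (var k gF).
Local Notation L := (var k gL).
(* [Z true l] is Z_l^+ and [Z false l] is Z_l^- *)
Local Notation Z e l := (var k (gZ e l)).
Local Notation S s := (var k (gS s)).

(* the inverse of K, since K ^+ r' = 1 *)
Local Notation Kinv := (K ^+ r'.-1).
Local Notation Lbar := (K ^+ r'' * L).

Inductive A_rel : free_alg k (A_gen p) -> free_alg k (A_gen p) -> Prop :=
| A_Kr : A_rel (K ^+ r') 1
| A_Er : A_rel (E ^+ r') 0
| A_Fr : A_rel (F ^+ r') 0
| A_KE : A_rel (K * E * Kinv) (q ^+ 2 *: E)
| A_KF : A_rel (K * F * Kinv) (q ^- 2 *: F)
| A_EF : A_rel (E * F - F * E) ((q - q^-1)^-1 *: (K - Kinv))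
| A_LL : A_rel (L ^+ 2) 1
| A_LZ e l : A_rel (L * Z e l) (- (Z e l * L))
| A_Z2 e l : A_rel (Z e l ^+ 2) 0
| A_ZZ e l e' l' : A_rel (Z e l * Z e' l') (- (Z e' l' * Z e l))
| A_LK : A_rel (L * K) (K * L)
| A_LE : A_rel (L * E) (E * L)
| A_LF : A_rel (L * F) (F * L)
| A_KZ e l : A_rel (K * Z e l) (- (Z e l * K))
| A_EZ e l : A_rel (E * Z e l) (- (Z e l * E))
| A_FZ e l : A_rel (F * Z e l) (Z e l * F)
| A_S1 : A_rel (S 1%g) 1
| A_SS s t : A_rel (S s * S t) (S (t * s)%g)
| A_SE s : A_rel (S s * E) (E * S s)
| A_SF s : A_rel (S s * F) (F * S s)
| A_SK s : A_rel (S s * K) (K * S s)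
| A_SL s : A_rel (S s * L) (L * S s)
| A_SZ s e l : A_rel (S s * Z e l) (Z e (s l) * S s).

Local Notation "a ⊗ b" := (pure2 a b).

Definition A_coprod (x : A_gen p) : free_alg2 k (A_gen p) :=
  match x with
  | gK => K ⊗ K
  | gE => 1 ⊗ E + E ⊗ K
  | gF => F ⊗ 1 + Kinv ⊗ F
  | gL => L ⊗ L
  | gZ e l => 1 ⊗ Z e l + Z e l ⊗ Lbar
  | gS s => S s ⊗ S s
  end.

Definition A_counit (x : A_gen p) : k :=
  match x with
  | gK | gL | gS _ => 1
  | gE | gF | gZ _ _ => 0
  end.

Definition R_z : free_alg2 k (A_gen p) :=
  2%:R^-1 *: \sum_(v < 2) \sum_(w < 2) (-1) ^+ (v * w) *: (L ^+ w ⊗ L ^+ v).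

Definition R_D : free_alg2 k (A_gen p) :=
  r'%:R^-1 *:
    \sum_(b < r') \sum_(c < r') q ^- (2 * b * c) *: (K ^+ b ⊗ K ^+ c).

Definition R_Theta : free_alg2 k (A_gen p) :=
  \sum_(a < r')
    (qbrace 1 ^+ a / qfact a * q ^+ (a * a.-1)./2) *: (E ^+ a ⊗ F ^+ a).

(* The summands x of the exponent commute and square to zero, so that the
   exponential is the sum over all sets of summands of their product. *)
Definition R_alpha_summand (x : bool * 'I_p) : free_alg2 k (A_gen p) :=
  let: (e, l) := x in
  ((-1) ^+ (~~ e) * alpha l) *: (Z e l ⊗ (Lbar * Z (~~ e) l)).

Definition R_alpha : free_alg2 k (A_gen p) :=
  \sum_(I : {set bool * 'I_p}) \prod_(x in I) R_alpha_summand x.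

Definition A_alg : presentation k :=
  Presentation A_rel A_coprod A_counit (R_z * R_D * R_Theta * R_alpha).

End AlgebraA.

(* Main.v *)
(* A transparent module is one on which E, F and the Z_l^+- act by zero and
   K^2 = 1: transparency against the three-dimensional simple U-module forces
   F = 0, K^2 = 1 and E = 0, and transparency against the truncation of the
   exterior algebra SF_{2p} in degree <= 1 then forces Z_l^+- = 0, because p > 2
   and alpha_l <> 0.  On such modules every generator acts as if it were
   grouplike, and R acts as R_z, so the centre is a category of representations
   of a finite group with the braiding twisted by the sign rule for the
   involution L.  This is symmetric for any alpha, although R intertwines the
   coproduct of S_p only when alpha is constant.

   Inflation along A -> K[S_p] lands in the centre on the modules with L = 1,
   where the braiding is the flip.  The inflated permutation module of dimension
   p is not a direct sum of simples: one of the projections would be nonzero,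
   hence split injective, on the line of invariants, but an invariant functional
   takes the value p c = 0 on the invariant vector. *)
From HB Require Import structures.
From mathcomp Require Import all_boot all_order all_algebra all_fingroup finmap.
From mathcomp.multinomials Require Import monalg.
Require Import Defs.

Set Implicit Arguments.
Unset Strict Implicit.
Unset Printing Implicit Defensive.

Import GRing.Theory.
Local Open Scope ring_scope.

(** * Tensor products of vector spaces *)

(** For non-constant alpha no braided structure on [A]-mod is at hand from which the centre could
    inherit its laws. They are proved by hand on pure tensors, once for every class of modules
    satisfying [super_class]; the Mueger centre and K[S_p]-mod (with trivial parity) are two
    instances.

    The factors D and R_z are finite Fourier transforms: if K x = q^(2j) x, then D sends x ⊗ w to x
    ⊗ K^j w, and R_z does the same with L. The eigenvalues 1 and -1 of K are q^(2j) for j = 0 and j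
    = r''. So an eigenvector of a central module moves past any w at the cost of an operator built
    from K^r'' and L, whose square is 1.

    In the converse direction the order of the detections matters. F = 0 and K^2 = 1 are read off
    from the lowest vector of the triplet, E = 0 from the middle one once F = 0 is known, and the
    Z_l last, when Theta and D have become trivial. Since [R_alpha] couples Z_l^+ with Z_l^-, each
    sign needs its own test module. Both braidings contribute the same multiple of alpha_l, so
    nothing cancels and a factor 2 appears. *)

Section TensorProduct.
Variable k : fieldType.
Implicit Types U V W : vectType k.

(** The sum is linear in [t] for every [b], which is what [linfun] requires. Nested lifts such as
    [tassoc] use this form to check linearity in a parameter of the inner map. *)
Lemma tliftEw U V W (b : U -> V -> W) (t : tprod U V) :
  tlift b t =
  \sum_i \sum_j (t : 'M[k]_(_, _)) i j *: b (vbasis {:U})`_i (vbasis {:V})`_j.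
Proof.
pose phi (t : tprod U V) : W :=
  \sum_i \sum_j (t : 'M[k]_(_, _)) i j *: b (vbasis {:U})`_i (vbasis {:V})`_j.
have phi_lin : linear phi.
  move=> c s s'; rewrite scaler_sumr -big_split; apply: eq_bigr => i _ /=.
  rewrite scaler_sumr -big_split; apply: eq_bigr => j _ /=.
  by rewrite !mxE scalerDl scalerA.
pose phim := GRing.isLinear.Build k _ W _ phi phi_lin.
pose phil : {linear tprod U V -> W} := HB.pack phi phim.
by rewrite /tlift -[linfun _]/(linfun phil) lfunE.
Qed.

Lemma tpure_is_linear_l U V (v : V) : linear ((@tpure k U V)^~ v).
Proof. by move=> c s t; apply/matrixP=> i j; rewrite !mxE linearP mulrDl mulrA. Qed.

Lemma tpure_is_linear_r U V (u : U) : linear (@tpure k U V u).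
Proof. by move=> c s t; apply/matrixP=> i j; rewrite !mxE linearP mulrDr mulrCA. Qed.

HB.instance Definition _ U V u :=
  GRing.isLinear.Build k V (tprod U V) _ (@tpure k U V u) (tpure_is_linear_r u).

(** A constant of its own, to which the linear structure in the left argument can be attached. *)
Definition tpure_left U V (v : V) (u : U) : tprod U V := tpure u v.

HB.instance Definition _ U V v :=
  GRing.isLinear.Build k U (tprod U V) _ (@tpure_left U V v) (tpure_is_linear_l v).

Lemma tpureDl U V (u u' : U) (v : V) :
  tpure (u + u') v = tpure u v + tpure u' v.
Proof. exact: (linearD (tpure_left v)). Qed.

Lemma tpure0l U V (v : V) : tpure (0 : U) v = 0.
Proof. exact: (linear0 (tpure_left v)). Qed.

Lemma tpureZl U V c (u : U) (v : V) : tpure (c *: u) v = c *: tpure u v.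
Proof. by rewrite -[LHS]/(tpure_left v _) linearZ. Qed.

Lemma tpureDr U V (u : U) (v v' : V) :
  tpure u (v + v') = tpure u v + tpure u v'.
Proof. exact: linearD. Qed.

Lemma tpure0r U V (u : U) : tpure u (0 : V) = 0.
Proof. exact: linear0. Qed.

Lemma tpureZr U V c (u : U) (v : V) : tpure u (c *: v) = c *: tpure u v.
Proof. by rewrite linearZ. Qed.

Lemma tpureNl U V (u : U) (v : V) : tpure (- u) v = - tpure u v.
Proof. exact: (linearN (tpure_left v)). Qed.

Lemma tpureNr U V (u : U) (v : V) : tpure u (- v) = - tpure u v.
Proof. exact: linearN. Qed.

Definition tpureE := (tpureDl, tpureDr, tpureZl, tpureZr, tpureNl, tpureNr,
  tpure0l, tpure0r).

(** Tensors are matrices, and the elementary matrices are the pure tensors of basis vectors. *)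
Lemma tprod_ext U V W (f g : 'Hom(tprod U V, W)) :
  (forall u v, f (tpure u v) = g (tpure u v)) -> f = g.
Proof.
move=> fg; apply/lfunP=> t; rewrite [t](matrix_sum_delta t) !linear_sum.
apply: eq_bigr => i _ /=; rewrite !linear_sum; apply: eq_bigr => j _ /=.
rewrite !linearZ /=; congr (_ *: _).
suff -> : delta_mx i j = tpure (vbasis {:U})`_i (vbasis {:V})`_j by [].
apply/matrixP=> i' j'; rewrite !mxE !coord_free ?(basis_free (vbasisP _)) //.
by rewrite -natrM mulnb (eq_sym i) (eq_sym j).
Qed.

Lemma tmapE U U' V V' (f : 'Hom(U, U')) (g : 'Hom(V, V')) u v :
  tmap f g (tpure u v) = tpure (f u) (g v).
Proof.
by rewrite tliftE // => [{}v|{}u] c x y; rewrite linearP !tpureE.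
Qed.

Lemma tassocE U V W (u : U) (v : V) (w : W) :
  tassoc U V W (tpure (tpure u v) w) = tpure u (tpure v w).
Proof.
rewrite tliftE => [|{}w c x y|t c x y]; last 2 first.
- exact: linearP.
- rewrite !tliftEw scaler_sumr -big_split; apply: eq_bigr => i _ /=.
  rewrite scaler_sumr -big_split; apply: eq_bigr => j _ /=.
  by rewrite !tpureE scalerDr !scalerA mulrC.
by rewrite tliftE // => [{}v|{}u] c x y; rewrite !tpureE.
Qed.

Lemma tassociE U V W (u : U) (v : V) (w : W) :
  tassoci U V W (tpure u (tpure v w)) = tpure (tpure u v) w.
Proof.
rewrite tliftE => [|t c x y|{}u c x y]; last 2 first.
- rewrite !tliftEw scaler_sumr -big_split; apply: eq_bigr => i _ /=.
  rewrite scaler_sumr -big_split; apply: eq_bigr => j _ /=.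
  by rewrite !tpureE scalerDr !scalerA mulrC.
- exact: linearP.
by rewrite tliftE // => [{}w|{}v] c x y; rewrite !tpureE.
Qed.

Lemma tlunitE V (c : k^o) (v : V) : tlunit V (tpure c v) = c *: v.
Proof.
by rewrite tliftE // => [{}v|{}c] d x y; rewrite (scalerDl, scalerDr) !scalerA // mulrC.
Qed.

Lemma trunitE V (c : k^o) (v : V) : trunit V (tpure v c) = c *: v.
Proof.
by rewrite tliftE // => [{}c|{}v] d x y; rewrite (scalerDl, scalerDr) !scalerA // mulrC.
Qed.

Lemma tflipE U V (u : U) (v : V) : tflip U V (tpure u v) = tpure v u.
Proof. by rewrite tliftE // => [{}v|{}u] c x y; rewrite !tpureE. Qed.

Lemma tprod_ext3l T U V W (f g : 'Hom(tprod (tprod T U) V, W)) :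
  (forall t u v, f (tpure (tpure t u) v) = g (tpure (tpure t u) v)) -> f = g.
Proof.
move=> fg; apply: tprod_ext => s v.
(* For fixed [v] both sides are linear in [s], which is itself a tensor, so that [tprod_ext] applies
   again. *)
have /lfunP/(_ s) : (f \o linfun (tpure_left v) = g \o linfun (tpure_left v))%VF; last first.
  by rewrite !comp_lfunE !lfunE.
by apply: tprod_ext => t u; rewrite !comp_lfunE !lfunE; apply: fg.
Qed.

Lemma tprod_ext3r T U V W (f g : 'Hom(tprod T (tprod U V), W)) :
  (forall t u v, f (tpure t (tpure u v)) = g (tpure t (tpure u v))) -> f = g.
Proof.
move=> fg; apply: tprod_ext => t s.
have /lfunP/(_ s) : (f \o linfun (tpure t) = g \o linfun (tpure t))%VF; last first.
  by rewrite !comp_lfunE !lfunE.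
by apply: tprod_ext => u v; rewrite !comp_lfunE !lfunE; apply: fg.
Qed.

Lemma tprod_ext4 S T U V W (f g : 'Hom(tprod (tprod (tprod S T) U) V, W)) :
  (forall s t u v, f (tpure (tpure (tpure s t) u) v)
    = g (tpure (tpure (tpure s t) u) v)) -> f = g.
Proof.
move=> fg; apply: tprod_ext => s v.
have /lfunP/(_ s) : (f \o linfun (tpure_left v) = g \o linfun (tpure_left v))%VF; last first.
  by rewrite !comp_lfunE !lfunE.
by apply: tprod_ext3l => t u w; rewrite !comp_lfunE !lfunE; apply: fg.
Qed.

Lemma tmap1 U V : tmap \1 \1 = \1%VF :> 'End(tprod U V).
Proof. by apply: tprod_ext => u v; rewrite tmapE !id_lfunE. Qed.

Lemma tmap_comp U U' U'' V V' V'' (f' : 'Hom(U', U'')) (f : 'Hom(U, U'))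
    (g' : 'Hom(V', V'')) (g : 'Hom(V, V')) :
  (tmap (f' \o f) (g' \o g) = tmap f' g' \o tmap f g)%VF.
Proof. by apply: tprod_ext => u v; rewrite comp_lfunE !tmapE !comp_lfunE. Qed.

Lemma tmap0l U U' V V' (g : 'Hom(V, V')) : tmap 0 g = 0 :> 'Hom(tprod U V, tprod U' V').
Proof. by apply: tprod_ext => u v; rewrite tmapE !zero_lfunE tpure0l. Qed.

Lemma tmap0r U U' V V' (f : 'Hom(U, U')) : tmap f 0 = 0 :> 'Hom(tprod U V, tprod U' V').
Proof. by apply: tprod_ext => u v; rewrite tmapE !zero_lfunE tpure0r. Qed.

End TensorProduct.

(** * Evaluation of noncommutative polynomials *)

Section Evaluation.
Variable k : fieldType.

Section OneSpace.
Variables (X : choiceType) (V : vectType k) (rho : X -> 'End(V)).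
Implicit Types a b : free_alg k X.

Lemma eq_eval (rho' : X -> 'End(V)) : rho =1 rho' -> eval rho =1 eval rho'.
Proof.
by move=> eq_rho a; apply: eq_bigr => m _; congr (_ *: _); apply: eq_bigr.
Qed.

Lemma eval0 : eval rho 0 = 0.
Proof. by rewrite -(scale0r (0 : free_alg k X)) evalZ scale0r. Qed.

Lemma evalN a : eval rho (- a) = - eval rho a.
Proof. by rewrite -!scaleN1r evalZ. Qed.

Lemma evalB a b : eval rho (a - b) = eval rho a - eval rho b.
Proof. by rewrite evalD evalN. Qed.

Lemma eval_prod (I : Type) (s : seq I) (G : I -> free_alg k X) :
  eval rho (\prod_(i <- s) G i) =
  \big[@comp_lfun k V V V / \1%VF]_(i <- s) eval rho (G i).
Proof. by elim: s => [|i s IHs]; rewrite ?big_nil ?eval1 // !big_cons evalM IHs. Qed.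

Lemma eval_expS a n : eval rho (a ^+ n.+1) = (eval rho a \o eval rho (a ^+ n))%VF.
Proof. by rewrite exprS evalM. Qed.

Lemma eval_exp_var x n v : eval rho (var k x ^+ n) v = iter n (rho x) v.
Proof.
elim: n => [|n IHn]; first by rewrite eval1 id_lfunE.
by rewrite eval_expS comp_lfunE IHn eval_var.
Qed.

Lemma eval_exp_eigen a n c v :
  eval rho a v = c *: v -> eval rho (a ^+ n) v = c ^+ n *: v.
Proof.
move=> av; elim: n => [|n IHn]; first by rewrite eval1 id_lfunE scale1r.
by rewrite eval_expS comp_lfunE IHn linearZ /= av scalerA exprSr.
Qed.

(** In the formal exponential, a subset with two or more elements contributes a product that starts
    with two annihilating factors. *)
Lemma eval_sum_prod (I : finType) (G : I -> free_alg k X) :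
    (forall i j, eval rho (G i) \o eval rho (G j) = 0)%VF ->
  eval rho (\sum_(J : {set I}) \prod_(i in J) G i) = \1%VF + \sum_i eval rho (G i).
Proof.
move=> GG0; rewrite eval_sum (bigD1 set0) //= big_set0 eval1; congr (_ + _).
(* The linear terms are indexed by singletons, so that both sides become sums over non-empty
   subsets. *)
have -> : \sum_i eval rho (G i) =
    \sum_(J : {set I} | J != set0) \sum_(i | J == [set i]) eval rho (G i).
  rewrite (exchange_big_dep xpredT) //=; apply: eq_bigr => i _.
  rewrite (big_pred1 [set i]) // => J /=; case: (J =P [set i]) => [->|_];
    last by rewrite andbF.
  by rewrite andbT; apply/set0Pn; exists i; rewrite set11.
apply: eq_bigr => J J0; rewrite -[X in eval _ X]big_filter eval_prod.
set s := filter _ _; have s_uniq : uniq s := filter_uniq _ (index_enum_uniq I).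
have mem_s : s =i J by move=> i; rewrite mem_filter mem_index_enum andbT.
case: s => [|i [|j s]] in s_uniq mem_s *.
- by case/set0Pn: J0 => i; rewrite -mem_s.
- have -> : J = [set i] by apply/setP=> j; rewrite -mem_s !inE.
  rewrite big_cons big_nil comp_lfun1r (big_pred1 i) // => j.
  by rewrite (inj_eq set1_inj) eq_sym.
- rewrite !big_cons comp_lfunA GG0 comp_lfun0l big1 // => l /eqP JE.
  have /set1P il : i \in [set l] by rewrite -JE -mem_s mem_head.
  have /set1P jl : j \in [set l] by rewrite -JE -mem_s !inE eqxx orbT.
  by rewrite il jl /= mem_head in s_uniq.
Qed.

End OneSpace.

Lemma eval_algmorph (X : choiceType) (V W : vectType k) (rho : X -> 'End(V))
    (phi : 'End(V) -> 'End(W)) (a : free_alg k X) :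
    linear phi -> phi \1%VF = \1%VF ->
    (forall f g, phi (f \o g) = phi f \o phi g)%VF ->
  eval (phi \o rho) a = phi (eval rho a).
Proof.
move=> phi_lin phi1 phiM.
pose phim := GRing.isLinear.Build k _ _ _ phi phi_lin.
pose phil : {linear 'End(V) -> 'End(W)} := HB.pack phi phim.
rewrite /eval -[phi _]/(phil _) linear_sum; apply: eq_bigr => m _.
rewrite linearZ /=; congr (_ *: _).
by elim: (m : seq X) => [|x s IHs]; rewrite ?big_nil // !big_cons phiM -IHs.
Qed.

Lemma eval_subst (X Y : choiceType) (V : vectType k) (rho : Y -> 'End(V))
    (h : X -> free_alg k Y) (a : free_alg k X) :
  eval rho (subst h a) = eval (eval rho \o h) a.
Proof.
rewrite /subst mmapE eval_sum; apply: eq_bigr => m _.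
by rewrite evalM evalU fm1 big_nil eval_prod -comp_lfunZl comp_lfun1l.
Qed.

Lemma tmap_is_linear_l (U U' V V' : vectType k) (g : 'Hom(V, V')) :
  linear (fun f : 'Hom(U, U') => tmap f g).
Proof.
move=> c f f'; apply: tprod_ext => u v.
by rewrite !(add_lfunE, scale_lfunE, tmapE) tpureE tpureZl.
Qed.

Lemma tmap_is_linear_r (U U' V V' : vectType k) (f : 'Hom(U, U')) :
  linear (fun g : 'Hom(V, V') => tmap f g).
Proof.
move=> c g g'; apply: tprod_ext => u v.
by rewrite !(add_lfunE, scale_lfunE, tmapE) tpureE tpureZr.
Qed.

(** Polynomials in the left variables act through the algebra morphism f |-> f ⊗ 1, those in the
    right variables through g |-> 1 ⊗ g; the composite of the two is f ⊗ g. *)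
Lemma eval_pure2 (A : presentation k) (V W : rep A) (a b : free_alg k (gen A)) :
  eval (act2 V W) (pure2 a b) = tmap (eval (@act k A V) a) (eval (@act k A W) b).
Proof.
pose left_op (f : 'End(space V)) : 'End(tprod (space V) (space W)) := tmap f \1%VF.
pose right_op (g : 'End(space W)) : 'End(tprod (space V) (space W)) := tmap \1%VF g.
have left_eval : eval (left_op \o @act k A V) a = left_op (eval (@act k A V) a).
  apply: eval_algmorph; [exact: tmap_is_linear_l | exact: tmap1 | move=> f g].
  by rewrite /left_op -tmap_comp comp_lfun1l.
have right_eval : eval (right_op \o @act k A W) b = right_op (eval (@act k A W) b).
  apply: eval_algmorph; [exact: tmap_is_linear_r | exact: tmap1 | move=> f g].
  by rewrite /right_op -tmap_comp comp_lfun1l.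
have evall : eval (act2 V W) (subst (fun x => var k (inl x)) a)
    = left_op (eval (@act k A V) a).
  by rewrite -left_eval eval_subst; apply: eq_eval => x; exact: eval_var.
have evalr : eval (act2 V W) (subst (fun x => var k (inr x)) b)
    = right_op (eval (@act k A W) b).
  by rewrite -right_eval eval_subst; apply: eq_eval => x; exact: eval_var.
apply: etrans (evalM _ _ _) (etrans (congr2 _ evall evalr) _).
by rewrite -tmap_comp comp_lfun1l comp_lfun1r.
Qed.

End Evaluation.

(** * Symmetric categories of super type *)

Section GrouplikeModules.
Variables (k : fieldType) (A : presentation k).

(** Convertible to [modcat A] when [P] is [is_module], and to its Mueger centre when [P] also
    demands transparency; one proof of the laws thus covers both. *)
Definition full_subcat (P : rep A -> Prop) : bmcat :=
  BMCat P (@is_hom (modcat A)) (@idm (modcat A)) (@comp (modcat A))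
    (@tensm (modcat A)) (@assoc (modcat A)) (@associ (modcat A))
    (@lunit (modcat A)) (@runit (modcat A)) (@braid (modcat A)).

(* On the modules in [P] all generators act as if they were grouplike (those
   that are not act by zero) and the R-matrix acts by the sign rule for the
   parity given by the involution [l]. *)
Record super_class (l : gen A) (P : rep A -> Prop) : Prop := SuperClass {
  super_one : P (rep_one A);
  super_tens : forall X Y, P X -> P Y -> P (rep_tens X Y);
  super_counit : forall X x, P X -> counit x *: act X x = act X x;
  super_coprod : forall X Y x, P X -> P Y ->
    eval (act2 X Y) (coprod x) = tmap (act X x) (act Y x);
  super_invol : forall X, P X -> (act X l \o act X l)%VF = \1%VF;
  super_comm : forall X x, P X -> (act X l \o act X x = act X x \o act X l)%VF;
  super_Rmat : forall X Y, P X -> P Y ->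
    eval (act2 X Y) (Rmat A) = 2%:R^-1 *:
      (tmap \1 \1 + tmap (act X l) \1 + tmap \1 (act Y l)
       - tmap (act X l) (act Y l))%VF
}.

Variables (l : gen A) (P : rep A -> Prop).
Hypothesis two_neq0 : 2%:R != 0 :> k.
Hypothesis superP : super_class l P.
Implicit Types X Y Z W : rep A.

Local Notation C := (full_subcat P).

(** On modules in [P], [even_part] and [odd_part] are the projections on the eigenspaces of the
    involution [l]. *)
Definition even_part X : 'End(space X) := 2%:R^-1 *: (\1%VF + act X l).
Definition odd_part X : 'End(space X) := 2%:R^-1 *: (\1%VF - act X l).

Lemma even_partE X v : even_part X v = 2%:R^-1 *: (v + act X l v).
Proof. by rewrite scale_lfunE add_lfunE id_lfunE. Qed.

Lemma odd_partE X v : odd_part X v = 2%:R^-1 *: (v - act X l v).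
Proof. by rewrite scale_lfunE add_lfunE opp_lfunE id_lfunE. Qed.

Lemma even_odd_part X v : even_part X v + odd_part X v = v.
Proof.
rewrite even_partE odd_partE -scalerDr addrACA addrN addr0.
by rewrite -mulr2n -scaler_nat scalerA mulVf // scale1r.
Qed.

Lemma superK X v : P X -> act X l (act X l v) = v.
Proof. by move=> PX; rewrite -comp_lfunE (super_invol superP PX) id_lfunE. Qed.

Lemma parity_even X v : P X -> act X l (even_part X v) = even_part X v.
Proof. by move=> PX; rewrite even_partE linearZ /= linearD /= superK // addrC. Qed.

Lemma parity_odd X v : P X -> act X l (odd_part X v) = - odd_part X v.
Proof.
by move=> PX; rewrite odd_partE linearZ /= linearB /= superK // -scalerN opprB.
Qed.

Lemma even_part_fix X v : act X l v = v -> even_part X v = v /\ odd_part X v = 0.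
Proof.
move=> lv; have ov : odd_part X v = 0 by rewrite odd_partE lv addrN scaler0.
by split; rewrite // -[RHS]even_odd_part ov addr0.
Qed.

Lemma odd_part_fix X v : act X l v = - v -> even_part X v = 0 /\ odd_part X v = v.
Proof.
move=> lv; have ev : even_part X v = 0 by rewrite even_partE lv addrN scaler0.
by split; rewrite // -[RHS]even_odd_part ev add0r.
Qed.

Lemma module_homE X Y (f : 'Hom(space X, space Y)) x v :
  is_module_hom f -> f (act X x v) = act Y x (f v).
Proof. by move=> fhom; rewrite -!comp_lfunE fhom. Qed.

Lemma even_part_hom X Y f v : is_module_hom f ->
  even_part Y (f v) = f (even_part X v).
Proof.
by move=> fhom; rewrite !even_partE -(module_homE l v fhom) -linearD -linearZ.
Qed.

Lemma odd_part_hom X Y f v : is_module_hom f ->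
  odd_part Y (f v) = f (odd_part X v).
Proof.
by move=> fhom; rewrite !odd_partE -(module_homE l v fhom) -linearB -linearZ.
Qed.

Lemma super_act_tens X Y x u v : P X -> P Y ->
  act (rep_tens X Y) x (tpure u v) = tpure (act X x u) (act Y x v).
Proof. by move=> PX PY; rewrite /= (super_coprod superP) // tmapE. Qed.

(** The sign rule 1/2 (1 ⊗ 1 + l ⊗ 1 + 1 ⊗ l - l ⊗ l) regroups as even ⊗ 1 + odd ⊗ l. *)
Lemma super_RmatE X Y u v : P X -> P Y ->
  eval (act2 X Y) (Rmat A) (tpure u v) =
  tpure (even_part X u) v + tpure (odd_part X u) (act Y l v).
Proof.
move=> PX PY; rewrite (super_Rmat superP) // even_partE odd_partE.
rewrite scale_lfunE !(add_lfunE, opp_lfunE) !tmapE !id_lfunE.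
by rewrite !tpureE -scalerDr !addrA.
Qed.

Lemma super_flipE X Y u v : P X -> P Y ->
  tflip (space X) (space Y) (eval (act2 X Y) (Rmat A) (tpure u v)) =
  tpure v (even_part X u) + tpure (act Y l v) (odd_part X u).
Proof.
by move=> PX PY; rewrite super_RmatE // linearD /= !tflipE.
Qed.

(** The sign rule is symmetric in its two arguments, so the parity splitting may be done on [v].
    This form serves when [v] is homogeneous, or when [u] is a tensor product. *)
Lemma super_flipE' X Y u v : P X -> P Y ->
  tflip (space X) (space Y) (eval (act2 X Y) (Rmat A) (tpure u v)) =
  tpure (even_part Y v) u + tpure (odd_part Y v) (act X l u).
Proof.
move=> PX PY; rewrite super_flipE // !(even_partE, odd_partE) !tpureE.
rewrite -!scalerDr !addrA; congr (_ *: (_ - _)).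
by rewrite -!addrA; congr (_ + _); rewrite addrC.
Qed.

Lemma super_braidE X Y u v : P X -> P Y ->
  rep_braid X Y (tpure u v) =
  tpure v (even_part X u) + tpure (act Y l v) (odd_part X u).
Proof. by move=> PX PY; rewrite comp_lfunE super_flipE. Qed.

Lemma super_braidE' X Y u v : P X -> P Y ->
  rep_braid X Y (tpure u v) =
  tpure (even_part Y v) u + tpure (odd_part Y v) (act X l u).
Proof. by move=> PX PY; rewrite comp_lfunE super_flipE'. Qed.

Lemma super_category : is_category C.
Proof.
split=> //=.
- by move=> X _ x; rewrite comp_lfun1l comp_lfun1r.
- by move=> X Y Z g f _ _ _ gh fh x; rewrite -comp_lfunA fh comp_lfunA gh comp_lfunA.
- by move=> X Y _ _ x; rewrite comp_lfun0l comp_lfun0r.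
- move=> X Y f g _ _ fh gh x.
  by rewrite comp_lfunDl comp_lfunDr comp_lfunNl comp_lfunNr fh gh.
- by move=> W X Y Z h g f *; rewrite comp_lfunA.
- by move=> X Y f *; rewrite comp_lfun1l.
- by move=> X Y f *; rewrite comp_lfun1r.
- by move=> X Y Z g g' f *; rewrite comp_lfunDl.
- by move=> X Y Z g f f' *; rewrite comp_lfunDr.
Qed.

Lemma super_tensm_hom X X' Y Y' (f : 'Hom(space X, space X'))
    (g : 'Hom(space Y, space Y')) :
  P X -> P X' -> P Y -> P Y' -> is_module_hom f -> is_module_hom g ->
  @is_module_hom k A (rep_tens X Y) (rep_tens X' Y') (tmap f g).
Proof.
move=> PX PX' PY PY' fh gh x; rewrite /= !(super_coprod superP) //.
by rewrite -!tmap_comp fh gh.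
Qed.

Lemma super_assoc_hom X Y Z : P X -> P Y -> P Z ->
  @is_module_hom k A (rep_tens (rep_tens X Y) Z) (rep_tens X (rep_tens Y Z))
    (tassoc (space X) (space Y) (space Z)).
Proof.
move=> PX PY PZ x; have tensP := super_tens superP.
apply: tprod_ext3l => u v w.
rewrite !comp_lfunE tassocE (@super_act_tens (rep_tens X Y) Z); auto.
rewrite (@super_act_tens X (rep_tens Y Z)); auto.
by rewrite (@super_act_tens X Y) // (@super_act_tens Y Z) // tassocE.
Qed.

Lemma super_associ_hom X Y Z : P X -> P Y -> P Z ->
  @is_module_hom k A (rep_tens X (rep_tens Y Z)) (rep_tens (rep_tens X Y) Z)
    (tassoci (space X) (space Y) (space Z)).
Proof.
move=> PX PY PZ x; have tensP := super_tens superP.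
apply: tprod_ext3r => u v w.
rewrite !comp_lfunE tassociE (@super_act_tens (rep_tens X Y) Z); auto.
rewrite (@super_act_tens X (rep_tens Y Z)); auto.
by rewrite (@super_act_tens X Y) // (@super_act_tens Y Z) // tassociE.
Qed.

Lemma super_monoidal : is_monoidal C.
Proof.
have tensP := super_tens superP; have oneP := super_one superP.
split=> //=.
- exact: super_category.
- exact: super_tensm_hom.
- by move=> X Y *; rewrite tmap1.
- by move=> *; rewrite tmap_comp.
- move=> X Y Z PX PY PZ; split.
  + exact: super_assoc_hom.
  + exact: super_associ_hom.
  + by apply: tprod_ext3l => u v w; rewrite comp_lfunE tassocE tassociE id_lfunE.
  + by apply: tprod_ext3r => u v w; rewrite comp_lfunE tassociE tassocE id_lfunE.
- move=> X X' Y Y' Z Z' f g h *; apply: tprod_ext3l => u v w.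
  by rewrite !comp_lfunE !(tmapE, tassocE).
- move=> X PX; split.
    move=> x; apply: tprod_ext => c v.
    rewrite !comp_lfunE (@super_act_tens (rep_one A) X) //= !tlunitE.
    rewrite scale_lfunE id_lfunE linearZ /=.
    (* Equivariance of the unit comes down to [super_counit]: a generator whose counit is not 1 acts
       by zero. *)
    by rewrite -scalerA scalerA mulrC -scalerA -scale_lfunE (super_counit superP).
  pose i := linfun (tpure (1 : k^o) : space X -> tprod k^o (space X)).
  have iE v : i v = tpure (1 : k^o) v by rewrite lfunE.
  exists i; split.
  + move=> x; apply/lfunP=> v; rewrite !comp_lfunE !iE (@super_act_tens (rep_one A) X) //=.
    by rewrite scale_lfunE id_lfunE !tpureE -tpureZr -scale_lfunE (super_counit superP).
  + apply: tprod_ext => c v; rewrite comp_lfunE tlunitE iE id_lfunE tpureZr -tpureZl.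
    by congr tpure; exact: mulr1.
  + by apply/lfunP=> v; rewrite comp_lfunE iE tlunitE scale1r id_lfunE.
- move=> X X' f *; apply: tprod_ext => c v.
  by rewrite !comp_lfunE tmapE !tlunitE id_lfunE linearZ.
- move=> X PX; split.
    move=> x; apply: tprod_ext => v c.
    rewrite !comp_lfunE (@super_act_tens X (rep_one A)) //= !trunitE.
    rewrite scale_lfunE id_lfunE linearZ /=.
    by rewrite -scalerA scalerA mulrC -scalerA -scale_lfunE (super_counit superP).
  pose i := linfun (tpure_left (1 : k^o) : space X -> tprod (space X) k^o).
  have iE v : i v = tpure v (1 : k^o) by rewrite lfunE.
  exists i; split.
  + move=> x; apply/lfunP=> v; rewrite !comp_lfunE !iE (@super_act_tens X (rep_one A)) //=.
    by rewrite scale_lfunE id_lfunE !tpureE -tpureZl -scale_lfunE (super_counit superP).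
  + apply: tprod_ext => v c; rewrite comp_lfunE trunitE iE id_lfunE tpureZl -tpureZr.
    by congr tpure; exact: mulr1.
  + by apply/lfunP=> v; rewrite comp_lfunE iE trunitE scale1r id_lfunE.
- move=> X X' f *; apply: tprod_ext => v c.
  by rewrite !comp_lfunE tmapE !trunitE id_lfunE linearZ.
- move=> W X Y Z *; apply: tprod_ext4 => t u v w.
  by rewrite !comp_lfunE !(tmapE, tassocE, id_lfunE).
- move=> X Y *; apply: tprod_ext3l => u c v.
  by rewrite !comp_lfunE !(tmapE, tassocE, tlunitE, trunitE, id_lfunE) !tpureE.
Qed.

(** After the first braiding the second factor is a parity component of [u]. The odd component makes
    both braidings apply [l] to [v], which cancels, and the components add up to [u]. *)
Lemma super_braidK X Y : P X -> P Y ->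
  (rep_braid Y X \o rep_braid X Y)%VF = \1%VF.
Proof.
move=> PX PY; apply: tprod_ext => u v.
rewrite !comp_lfunE super_flipE // !linearD /= !super_flipE' //.
have [-> ->] := even_part_fix (parity_even u PX).
have [-> ->] := odd_part_fix (parity_odd u PX).
by rewrite !tpure0l addr0 add0r superK // -tpureDl even_odd_part id_lfunE.
Qed.

Lemma super_braid_hom X Y : P X -> P Y ->
  @is_module_hom k A (rep_tens X Y) (rep_tens Y X) (rep_braid X Y).
Proof.
move=> PX PY x /=; rewrite !(super_coprod superP) //; apply: tprod_ext => u v.
rewrite !comp_lfunE tmapE !super_flipE // linearD /= !tmapE.
have evenC : even_part X (act X x u) = act X x (even_part X u).
  rewrite !even_partE -[act X l (act X x u)]comp_lfunE (super_comm superP _ PX).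
  by rewrite comp_lfunE -linearD -linearZ.
have oddC : odd_part X (act X x u) = act X x (odd_part X u).
  rewrite !odd_partE -[act X l (act X x u)]comp_lfunE (super_comm superP _ PX).
  by rewrite comp_lfunE -linearB -linearZ.
by rewrite evenC oddC -[act Y l (act Y x v)]comp_lfunE (super_comm superP) // comp_lfunE.
Qed.

Lemma super_symmetric : is_symmetric C.
Proof.
have tensP := super_tens superP.
split; last by move=> X Y; exact: super_braidK.
split=> /=; first exact: super_monoidal.
- move=> X Y PX PY; split; first exact: super_braid_hom.
  by exists (rep_braid Y X); split; [exact: super_braid_hom | exact: super_braidK ..].
- move=> X X' Y Y' f g PX PX' PY PY' fh gh; apply: tprod_ext => u v.
  rewrite !comp_lfunE tmapE !super_flipE // linearD /= !tmapE.
  rewrite (even_part_hom _ fh) (odd_part_hom _ fh).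
  by rewrite (module_homE _ _ gh).
(* The involution acts on [Y ⊗ Z] as l ⊗ l, so the odd part of [u] passes both factors at once as it
   passes them one by one. *)
- move=> X Y Z PX PY PZ; apply: tprod_ext3l => u v w.
  rewrite !comp_lfunE tassocE tmapE (@super_flipE X (rep_tens Y Z)); auto.
  rewrite super_braidE // !linearD /= id_lfunE.
  rewrite tpureDl !linearD /= (@super_act_tens Y Z) // !tassocE !tmapE !super_braidE //.
  have [-> ->] := even_part_fix (parity_even u PX).
  have [-> ->] := odd_part_fix (parity_odd u PX).
  by rewrite !id_lfunE !tpure0r addr0 add0r.
(* Here [w] is the factor that moves, so the parity splitting is done on [w] by the primed
   formulas. *)
- move=> X Y Z PX PY PZ; apply: tprod_ext3r => u v w.
  rewrite !comp_lfunE tassociE tmapE (@super_flipE' (rep_tens X Y) Z); auto.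
  rewrite super_braidE' // !linearD /= id_lfunE.
  rewrite (@super_act_tens X Y) // !tassociE !tmapE !super_braidE' //.
  have [-> ->] := even_part_fix (parity_even w PZ).
  have [-> ->] := odd_part_fix (parity_odd w PZ).
  by rewrite !id_lfunE !tpure0l addr0 add0r.
Qed.

End GrouplikeModules.

(** * The R-matrix on A-modules *)

Lemma sum_ord2_ord2 (V : nmodType) (f : nat -> nat -> V) :
  \sum_(v < 2) \sum_(w < 2) f v w = f 0%N 0%N + f 0%N 1%N + (f 1%N 0%N + f 1%N 1%N).
Proof. by rewrite !big_ord_recl !big_ord0 !addr0. Qed.

Section RMatrix.
Variables (k : fieldType) (p r : nat) (q : k) (alpha : 'I_p -> k).
Hypotheses (r_div8 : (8 %| r)%N) (q_root : r.-primitive_root q).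

Local Notation A := (A_alg r q alpha).
Local Notation r' := (r %/ 2)%N.
Local Notation r'' := (r %/ 4)%N.
Implicit Types X Y : rep A.

Lemma r_gt0 : (0 < r)%N.
Proof. exact: prim_order_gt0 q_root. Qed.

Lemma half_rE : (r' * 2)%N = r.
Proof. by rewrite divnK // (dvdn_trans _ r_div8). Qed.

Lemma quarter_rE : (r'' * 2)%N = r'.
Proof.
by apply/eqP; rewrite -(eqn_pmul2r (isT : 0 < 2)%N) half_rE -mulnA divnK //
  (dvdn_trans _ r_div8).
Qed.

(** Hence K^r'' = 1 wherever K^2 = 1; there [Lbar] acts as L. *)
Lemma quarter_r_even : r'' = ((r %/ 8) * 2)%N.
Proof.
by apply/eqP; rewrite -(eqn_pmul2r (isT : 0 < 4)%N) -mulnA !divnK //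
  (dvdn_trans _ r_div8).
Qed.

(** Leaves room in the range of [R_Theta] for the terms a = 0, 1, 2, and keeps q^2 and q^4 away from
    1. *)
Lemma half_r_ge4 : (4 <= r')%N.
Proof.
have r8 : (8 <= r)%N by rewrite dvdn_leq ?r_gt0.
by rewrite leq_divRL.
Qed.

Lemma half_r_gt0 : (0 < r')%N.
Proof. exact: leq_trans half_r_ge4. Qed.

Lemma q2_root : r'.-primitive_root (q ^+ 2).
Proof.
have := exp_prim_root q_root 2.
by rewrite (gcdn_idPl _) // (dvdn_trans _ r_div8).
Qed.

Lemma q_neq0 : q != 0.
Proof. by rewrite (prim_root_eq0 q_root) -lt0n r_gt0. Qed.

(** A field with a primitive root of unity of even order has characteristic other than 2. *)
Lemma two_neq0 : 2%:R != 0 :> k.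
Proof. by rewrite (prim_root_dvd_eq0 q_root) // (dvdn_trans _ r_div8). Qed.

Lemma half_r_neq0 : r'%:R != 0 :> k.
Proof. exact: prim_root_natf_neq0 q2_root. Qed.

(** Makes the eigenvalue -1 of K a weight q^(2j), namely for j = r''. *)
Lemma q_half : q ^+ (2 * r'') = -1.
Proof.
rewrite mulnC quarter_rE; have /eqP : (q ^+ r') ^+ 2 = 1.
  by rewrite -exprM half_rE (prim_expr_order q_root).
rewrite sqrf_eq1 -(prim_order_dvd q_root) => /orP[|/eqP//].
move=> /(dvdn_leq half_r_gt0); rewrite -[X in (X <= _)%N]half_rE.
by rewrite leqNgt ltn_Pmulr ?half_r_gt0.
Qed.

(** Orthogonality of the characters of Z/r': a geometric sum whose ratio [w] is an r'-th root of
    unity, equal to 1 only for c = j. *)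
Lemma root_sum j c : (j < r')%N -> (c < r')%N ->
  \sum_(b < r') q ^- (2 * b * c) * (q ^+ (2 * j)) ^+ b
  = if c == j then r'%:R else 0.
Proof.
move=> lt_j lt_c; pose w := q ^+ (2 * j) / q ^+ (2 * c).
rewrite (eq_bigr (fun b : 'I_r' => w ^+ b)) => [|b _]; last first.
  by rewrite exprMn exprVn -!exprM mulrC; congr (_ / q ^+ _); rewrite mulnAC.
case: (c =P j) => [cj|/eqP neq_cj].
  rewrite /w cj (eq_bigr (fun=> 1)) ?sumr_const ?card_ord // => b _.
  by rewrite divff ?expr1n // expf_neq0 ?q_neq0.
apply/eqP; have := subrX1 w r'.
have -> : w ^+ r' = 1.
  have q1 i : (q ^+ (2 * i)) ^+ r' = 1.
    by rewrite -exprM mulnAC [(2 * _)%N]mulnC half_rE exprM (prim_expr_order q_root) expr1n.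
  by rewrite exprMn exprVn !q1 divr1.
move/eqP; rewrite subrr eq_sym mulf_eq0 => /orP[|//]; rewrite subr_eq0 => /eqP w1.
case/negP: neq_cj; rewrite -[c](modn_small lt_c) -[j](modn_small lt_j).
rewrite -(eq_prim_root_expr q2_root) -!exprM -[X in X == _]mul1r -w1.
by rewrite mulfVK // expf_neq0 ?q_neq0.
Qed.

Lemma eval_R_z X Y x y :
  eval (act2 X Y) (R_z k p) (tpure x y) =
  2%:R^-1 *: (tpure x y + tpure (act X gL x) y + tpure x (act Y gL y)
              - tpure (act X gL x) (act Y gL y)).
Proof.
rewrite evalZ scale_lfunE; congr (_ *: _).
pose f v w : tprod (space X) (space Y) := (-1) ^+ (v * w) *:
  tpure (eval (@Defs.act k A X) (var k gL ^+ w) x)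
        (eval (@Defs.act k A Y) (var k gL ^+ v) y).
transitivity (\sum_(v < 2) \sum_(w < 2) f v w).
  rewrite eval_sum sum_lfunE; apply: eq_bigr => v _.
  rewrite eval_sum sum_lfunE; apply: eq_bigr => w _.
  by rewrite evalZ scale_lfunE eval_pure2 tmapE.
have fE v w : f v w = (-1) ^+ (v * w) *:
    tpure (iter w (act X gL) x) (iter v (act Y gL) y).
  by rewrite /f !eval_exp_var.
by rewrite sum_ord2_ord2 !fE !expr0 expr1 !scale1r scaleN1r !addrA.
Qed.

Lemma eval_R_D X Y x y :
  eval (act2 X Y) (R_D p r q) (tpure x y) =
  r'%:R^-1 *: \sum_(b < r') \sum_(c < r')
    q ^- (2 * b * c) *: tpure (eval (@Defs.act k A X) (var k gK ^+ b) x)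
                              (eval (@Defs.act k A Y) (var k gK ^+ c) y).
Proof.
rewrite evalZ scale_lfunE; congr (_ *: _).
rewrite eval_sum sum_lfunE; apply: eq_bigr => b _.
rewrite eval_sum sum_lfunE; apply: eq_bigr => c _.
by rewrite evalZ scale_lfunE eval_pure2 tmapE.
Qed.

(** Fourier inversion: summing over the powers of K on [x] leaves only the term c = j. *)
Lemma eval_R_D_left X Y x y j : (j < r')%N -> act X gK x = q ^+ (2 * j) *: x ->
  eval (act2 X Y) (R_D p r q) (tpure x y) =
  tpure x (eval (@Defs.act k A Y) (var k gK ^+ j) y).
Proof.
move=> lt_j xj; rewrite eval_R_D exchange_big /=.
have xe b : eval (@Defs.act k A X) (var k gK ^+ b) x = (q ^+ (2 * j)) ^+ b *: x.
  by apply: eval_exp_eigen; rewrite eval_var.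
rewrite (bigD1 (Ordinal lt_j)) //= addrC big1 ?add0r => [|c neq_cj].
  under eq_bigr do rewrite xe tpureZl scalerA.
  by rewrite -scaler_suml root_sum // eqxx scalerA mulVf ?half_r_neq0 ?scale1r.
under eq_bigr do rewrite xe tpureZl scalerA.
by rewrite -scaler_suml root_sum // -val_eqE /= in neq_cj *; rewrite (negPf neq_cj) scale0r.
Qed.

Lemma eval_R_D_right X Y x y j : (j < r')%N -> act Y gK y = q ^+ (2 * j) *: y ->
  eval (act2 X Y) (R_D p r q) (tpure x y) =
  tpure (eval (@Defs.act k A X) (var k gK ^+ j) x) y.
Proof.
move=> lt_j yj; rewrite eval_R_D.
have ye c : eval (@Defs.act k A Y) (var k gK ^+ c) y = (q ^+ (2 * j)) ^+ c *: y.
  by apply: eval_exp_eigen; rewrite eval_var.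
rewrite (bigD1 (Ordinal lt_j)) //= addrC big1 ?add0r => [|b neq_bj].
  under eq_bigr do rewrite ye tpureZr scalerA mulnAC.
  by rewrite -scaler_suml root_sum // eqxx scalerA mulVf ?half_r_neq0 ?scale1r.
under eq_bigr do rewrite ye tpureZr scalerA mulnAC.
by rewrite -scaler_suml root_sum // -val_eqE /= in neq_bj *; rewrite (negPf neq_bj) scale0r.
Qed.

Definition Theta_coef (a : nat) : k :=
  qbrace q 1 ^+ a / qfact q a * q ^+ (a * a.-1)./2.

Lemma eval_R_Theta X Y x y :
  eval (act2 X Y) (R_Theta p r q) (tpure x y) =
  \sum_(a < r') Theta_coef a *:
    tpure (eval (@Defs.act k A X) (var k gE ^+ a) x)
          (eval (@Defs.act k A Y) (var k gF ^+ a) y).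
Proof.
rewrite eval_sum sum_lfunE; apply: eq_bigr => a _.
by rewrite evalZ scale_lfunE eval_pure2 tmapE.
Qed.

(** A product of two summands dies as soon as one tensor leg does; the hypothesis lets each pair
    choose its leg. *)
Lemma eval_R_alpha X Y :
    (forall e l e' l',
       act X (gZ e l) \o act X (gZ e' l') = 0 \/
       eval (@Defs.act k A Y) (var k gK ^+ r'' * var k gL * var k (gZ (~~ e) l)) \o
       eval (@Defs.act k A Y) (var k gK ^+ r'' * var k gL * var k (gZ (~~ e') l'))
       = 0)%VF ->
  eval (act2 X Y) (R_alpha r alpha) =
  \1%VF + \sum_(i : bool * 'I_p) ((-1) ^+ (~~ i.1) * alpha i.2) *:
    tmap (act X (gZ i.1 i.2))
      (eval (@Defs.act k A Y) (var k gK ^+ r'' * var k gL * var k (gZ (~~ i.1) i.2))).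
Proof.
move=> ZZ0; have summandE (i : bool * 'I_p) : eval (act2 X Y) (R_alpha_summand r alpha i) =
    ((-1) ^+ (~~ i.1) * alpha i.2) *: tmap (act X (gZ i.1 i.2))
      (eval (@Defs.act k A Y) (var k gK ^+ r'' * var k gL * var k (gZ (~~ i.1) i.2))).
  by case: i => e l; rewrite evalZ eval_pure2 eval_var.
rewrite eval_sum_prod => [|i j].
  by congr (_ + _); apply: eq_bigr => i _; exact: summandE.
rewrite !summandE -comp_lfunZl -comp_lfunZr -tmap_comp.
by case: (ZZ0 i.1 i.2 j.1 j.2) => ->; rewrite (tmap0l, tmap0r) !scaler0.
Qed.

(** The rightmost factor [R_alpha] acts first. Naming the intermediate tensors lets each factor be
    computed by its own lemma. *)
Lemma eval_Rmat X Y t t1 t2 t3 t4 :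
    eval (act2 X Y) (R_alpha r alpha) t = t1 ->
    eval (act2 X Y) (R_Theta p r q) t1 = t2 ->
    eval (act2 X Y) (R_D p r q) t2 = t3 ->
    eval (act2 X Y) (R_z k p) t3 = t4 ->
  eval (act2 X Y) (Rmat A) t = t4.
Proof.
move=> <- <- <- <-; rewrite -!comp_lfunE; congr (fun_of_lfun _ t).
by apply: etrans (evalM _ _ _) _; congr comp_lfun; apply: etrans (evalM _ _ _) _;
  congr comp_lfun; apply: etrans (evalM _ _ _) _.
Qed.

End RMatrix.

(** * Central modules *)

Section ModuleCriterion.
Variables (k : fieldType) (p r : nat) (q : k) (alpha : 'I_p -> k).
Hypotheses (r_div8 : (8 %| r)%N) (q_root : r.-primitive_root q).

Local Notation A := (A_alg r q alpha).
Local Notation r' := (r %/ 2)%N.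
Local Notation r'' := (r %/ 4)%N.
Implicit Types X Y W : rep A.

(** [B] will be a basis for the test modules and the whole space for central modules. *)
Record A_relations_on X (B : space X -> Prop) : Prop := ARelationsOn {
  A_on_Kr : forall v, B v -> iter r' (act X gK) v = v;
  A_on_Er : forall v, B v -> iter r' (act X gE) v = 0;
  A_on_Fr : forall v, B v -> iter r' (act X gF) v = 0;
  A_on_KE : forall v, B v ->
    act X gK (act X gE (iter r'.-1 (act X gK) v)) = q ^+ 2 *: act X gE v;
  A_on_KF : forall v, B v ->
    act X gK (act X gF (iter r'.-1 (act X gK) v)) = q ^- 2 *: act X gF v;
  A_on_EF : forall v, B v -> act X gE (act X gF v) - act X gF (act X gE v) =
    (q - q^-1)^-1 *: (act X gK v - iter r'.-1 (act X gK) v);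
  A_on_LL : forall v, B v -> act X gL (act X gL v) = v;
  A_on_LZ : forall e l v, B v ->
    act X gL (act X (gZ e l) v) = - act X (gZ e l) (act X gL v);
  A_on_ZZ : forall e l e' l' v, B v ->
    act X (gZ e l) (act X (gZ e' l') v) = - act X (gZ e' l') (act X (gZ e l) v);
  A_on_Z2 : forall e l v, B v -> act X (gZ e l) (act X (gZ e l) v) = 0;
  A_on_LK : forall v, B v -> act X gL (act X gK v) = act X gK (act X gL v);
  A_on_LE : forall v, B v -> act X gL (act X gE v) = act X gE (act X gL v);
  A_on_LF : forall v, B v -> act X gL (act X gF v) = act X gF (act X gL v);
  A_on_KZ : forall e l v, B v ->
    act X gK (act X (gZ e l) v) = - act X (gZ e l) (act X gK v);
  A_on_EZ : forall e l v, B v ->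
    act X gE (act X (gZ e l) v) = - act X (gZ e l) (act X gE v);
  A_on_FZ : forall e l v, B v ->
    act X gF (act X (gZ e l) v) = act X (gZ e l) (act X gF v);
  A_on_S1 : forall v, B v -> act X (gS 1%g) v = v;
  A_on_SS : forall s t v, B v ->
    act X (gS s) (act X (gS t) v) = act X (gS (t * s)%g) v;
  A_on_SE : forall s v, B v ->
    act X (gS s) (act X gE v) = act X gE (act X (gS s) v);
  A_on_SF : forall s v, B v ->
    act X (gS s) (act X gF v) = act X gF (act X (gS s) v);
  A_on_SK : forall s v, B v ->
    act X (gS s) (act X gK v) = act X gK (act X (gS s) v);
  A_on_SL : forall s v, B v ->
    act X (gS s) (act X gL v) = act X gL (act X (gS s) v);
  A_on_SZ : forall s e l v, B v ->
    act X (gS s) (act X (gZ e l) v) = act X (gZ e (s l)) (act X (gS s) v)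
}.

Lemma A_relations_module X (B : space X -> Prop) :
    (forall f g : 'End(space X), (forall v, B v -> f v = g v) -> f = g) ->
  A_relations_on B -> is_module X.
Proof.
move=> span [Kr Er Fr KE KF EF LL LZ ZZ Z2 LK LE LF KZ EZ FZ S1 SS SE SF SK SL SZ].
pose ev := eval (@Defs.act k A X).
have ev1 x v : ev (var k x) v = act X x v by rewrite /ev eval_var.
have evM a b v : ev (a * b) v = ev a (ev b v).
  by rewrite -comp_lfunE; congr (fun_of_lfun _ v); exact: evalM.
have ev2 x y v : ev (var k x * var k y) v = act X x (act X y v) by rewrite evM !ev1.
have ev2N x y v : ev (- (var k x * var k y)) v = - act X x (act X y v).
  by rewrite -ev2 -opp_lfunE; congr (fun_of_lfun _ v); exact: evalN.
have evX x n v : ev (var k x ^+ n) v = iter n (act X x) v by exact: eval_exp_var.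
have ev0 v : ev 0 v = 0 by rewrite /ev eval0 zero_lfunE.
have evone v : ev 1 v = v by rewrite /ev eval1 id_lfunE.
have evZ c a v : ev (c *: a) v = c *: ev a v.
  by rewrite -scale_lfunE; congr (fun_of_lfun _ v); exact: evalZ.
have evB a b v : ev (a - b) v = ev a v - ev b v.
  by rewrite -opp_lfunE -add_lfunE; congr (fun_of_lfun _ v); exact: evalB.
move=> a b ab; apply: span => v Bv; rewrite -/ev.
case: ab => [|||||||e l|e l|e l e' l'||||e l|e l|e l||s t|s|s|s|s|s e l].
- by apply: etrans (evX _ _ _) (etrans _ (esym (evone _))); exact: Kr.
- by apply: etrans (evX _ _ _) (etrans _ (esym (ev0 _))); exact: Er.
- by apply: etrans (evX _ _ _) (etrans _ (esym (ev0 _))); exact: Fr.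
- apply: etrans (evM _ _ _) (etrans (ev2 _ _ _) (etrans _ (esym (evZ _ _ _)))).
  by rewrite evX ev1; exact: KE.
- apply: etrans (evM _ _ _) (etrans (ev2 _ _ _) (etrans _ (esym (evZ _ _ _)))).
  by rewrite evX ev1; exact: KF.
- apply: etrans (evB _ _ _) (etrans _ (esym (evZ _ _ _))).
  apply: etrans (congr2 (fun x y => x - y) (ev2 _ _ _) (ev2 _ _ _)) _.
  apply: etrans (EF v Bv) (congr1 _ (esym _)); apply: etrans (evB _ _ _) _.
  by congr (_ - _); [exact: ev1 | exact: evX].
- by apply: etrans (ev2 _ _ _) (etrans _ (esym (evone _))); exact: LL.
- by apply: etrans (ev2 _ _ _) (etrans _ (esym (ev2N _ _ _))); exact: LZ.
- by apply: etrans (ev2 _ _ _) (etrans _ (esym (ev0 _))); exact: Z2.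
- by apply: etrans (ev2 _ _ _) (etrans _ (esym (ev2N _ _ _))); exact: ZZ.
- by apply: etrans (ev2 _ _ _) (etrans _ (esym (ev2 _ _ _))); exact: LK.
- by apply: etrans (ev2 _ _ _) (etrans _ (esym (ev2 _ _ _))); exact: LE.
- by apply: etrans (ev2 _ _ _) (etrans _ (esym (ev2 _ _ _))); exact: LF.
- by apply: etrans (ev2 _ _ _) (etrans _ (esym (ev2N _ _ _))); exact: KZ.
- by apply: etrans (ev2 _ _ _) (etrans _ (esym (ev2N _ _ _))); exact: EZ.
- by apply: etrans (ev2 _ _ _) (etrans _ (esym (ev2 _ _ _))); exact: FZ.
- by apply: etrans (ev1 _ _) (etrans _ (esym (evone _))); exact: S1.
- by apply: etrans (ev2 _ _ _) (etrans _ (esym (ev1 _ _))); exact: SS.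
- by apply: etrans (ev2 _ _ _) (etrans _ (esym (ev2 _ _ _))); exact: SE.
- by apply: etrans (ev2 _ _ _) (etrans _ (esym (ev2 _ _ _))); exact: SF.
- by apply: etrans (ev2 _ _ _) (etrans _ (esym (ev2 _ _ _))); exact: SK.
- by apply: etrans (ev2 _ _ _) (etrans _ (esym (ev2 _ _ _))); exact: SL.
- by apply: etrans (ev2 _ _ _) (etrans _ (esym (ev2 _ _ _))); exact: SZ.
Qed.

End ModuleCriterion.

Lemma iter_involutive (T : Type) (f : T -> T) n v :
  involutive f -> iter (n * 2) f v = v.
Proof. by move=> fK; elim: n => //= n ->; rewrite fK. Qed.

Section CentralModules.
Variables (k : fieldType) (p r : nat) (q : k) (alpha : 'I_p -> k).
Hypotheses (r_div8 : (8 %| r)%N) (q_root : r.-primitive_root q).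

Local Notation A := (A_alg r q alpha).
Local Notation r' := (r %/ 2)%N.
Local Notation r'' := (r %/ 4)%N.
Implicit Types X Y W : rep A.

(** The sign (-1)^s is q^(2j) for j = [s * r'']; the bound admits this j in the Fourier inversion of
    D. *)
Lemma mul_bool_quarter_lt (s : bool) : (s * r'' < r')%N.
Proof.
have := half_r_gt0 r_div8 q_root; rewrite -(quarter_rE r_div8) muln_gt0 andbT.
move=> r''_gt0; apply: leq_ltn_trans (leq_mul (leq_b1 s) (leqnn r'')) _.
by rewrite mul1n ltn_Pmulr.
Qed.

Lemma iter_half_pred (T : Type) (f : T -> T) v :
  involutive f -> iter r'.-1 f v = f v.
Proof.
move=> fK; apply: (inv_inj fK); rewrite -iterS prednK ?(half_r_gt0 r_div8 q_root) //.
by rewrite -(quarter_rE r_div8) iter_involutive ?fK.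
Qed.

(** [R_z] is the analogue of D for the group Z/2 generated by L. *)
Lemma eval_R_z_left X Y x y (t : bool) : act X gL x = (-1) ^+ t *: x ->
  eval (act2 X Y) (R_z k p) (tpure x y) = tpure x (iter t (act Y gL) y).
Proof.
move=> xt; rewrite eval_R_z xt; case: t {xt} => /=; rewrite ?expr1 ?expr0.
  rewrite !scaleN1r !tpureNl opprK addrN add0r -mulr2n -scaler_nat scalerA.
  by rewrite mulVf ?scale1r // (two_neq0 r_div8 q_root).
rewrite !scale1r addrK -mulr2n -scaler_nat scalerA.
by rewrite mulVf ?scale1r // (two_neq0 r_div8 q_root).
Qed.

Lemma eval_R_z_right X Y x y (t : bool) : act Y gL y = (-1) ^+ t *: y ->
  eval (act2 X Y) (R_z k p) (tpure x y) = tpure (iter t (act X gL) x) y.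
Proof.
move=> yt; rewrite eval_R_z yt; case: t {yt} => /=; rewrite ?expr1 ?expr0.
  rewrite !scaleN1r !tpureNr opprK [tpure x y + _ - _]addrAC subrr add0r.
  by rewrite -mulr2n -scaler_nat scalerA mulVf ?scale1r // (two_neq0 r_div8 q_root).
rewrite !scale1r addrAC addrK -mulr2n -scaler_nat scalerA.
by rewrite mulVf ?scale1r // (two_neq0 r_div8 q_root).
Qed.

Lemma eval_R_Theta3 X Y x y :
    iter 3 (act X gE) x = 0 \/ iter 3 (act Y gF) y = 0 ->
  eval (act2 X Y) (R_Theta p r q) (tpure x y) =
  tpure x y + Theta_coef q 1 *: tpure (act X gE x) (act Y gF y)
  + Theta_coef q 2 *: tpure (act X gE (act X gE x)) (act Y gF (act Y gF y)).
Proof.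
move=> EF0; rewrite eval_R_Theta.
pose f a := Theta_coef q a *: tpure (iter a (act X gE) x) (iter a (act Y gF) y).
transitivity (\sum_(a < r') f a).
  by apply: eq_bigr => a _; rewrite /f !eval_exp_var.
have f0 a : f (a + 3)%N = 0.
  rewrite /f !iterD; case: EF0 => ->.
    suff -> : iter a (act X gE) 0 = 0 by rewrite tpure0l scaler0.
    by elim: a => //= a ->; rewrite linear0.
  suff -> : iter a (act Y gF) 0 = 0 by rewrite tpure0r scaler0.
  by elim: a => //= a ->; rewrite linear0.
(* Split the range as r' = 3 + (r' - 3); the second block vanishes by [f0]. *)
rewrite -(subnK (ltnW (half_r_ge4 r_div8 q_root))) addnC big_split_ord /= addrC.
rewrite big1 => [|a _]; last by rewrite /= addnC f0.
rewrite add0r !big_ord_recl big_ord0 addr0 addrA; congr (_ + _ + _).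
by rewrite /f /Theta_coef /qfact big_nil !expr0 divr1 mulr1 scale1r.
Qed.

Lemma eval_R_alpha_left X Y : (forall e l, act X (gZ e l) = 0) ->
  eval (act2 X Y) (R_alpha r alpha) = \1%VF.
Proof.
move=> Z0; rewrite eval_R_alpha => [|*]; last by left; rewrite !Z0 comp_lfun0l.
by rewrite big1 ?addr0 // => i _; rewrite Z0 tmap0l scaler0.
Qed.

Lemma eval_R_alpha_right X Y : (forall e l, act Y (gZ e l) = 0) ->
  eval (act2 X Y) (R_alpha r alpha) = \1%VF.
Proof.
move=> Z0; have Z0' e l :
    eval (@Defs.act k A Y) (var k gK ^+ r'' * var k gL * var k (gZ e l)) = 0.
  by apply: etrans (evalM _ _ _) _; rewrite eval_var Z0 comp_lfun0r.
have comp0 (f g : 'End(space Y)) : f = 0 -> (f \o g)%VF = 0.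
  by move=> ->; rewrite comp_lfun0l.
rewrite eval_R_alpha => [|e l e' l']; last first.
  by right; apply: comp0 (Z0' _ _).
by rewrite big1 ?addr0 // => i _; rewrite Z0' tmap0r scaler0.
Qed.

(** K, L and the [gS s] satisfy exactly the relations of Z/2 × Z/2 × S_p. *)
Record central X : Prop := Central {
  central_E : act X gE = 0;
  central_F : act X gF = 0;
  central_Z : forall e l, act X (gZ e l) = 0;
  central_KK : (act X gK \o act X gK = \1)%VF;
  central_LL : (act X gL \o act X gL = \1)%VF;
  central_LK : (act X gL \o act X gK = act X gK \o act X gL)%VF;
  central_S1 : act X (gS 1%g) = \1%VF;
  central_SS : forall s t,
    (act X (gS s) \o act X (gS t) = act X (gS (t * s)%g))%VF;
  central_SK : forall s, (act X (gS s) \o act X gK = act X gK \o act X (gS s))%VF;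
  central_SL : forall s, (act X (gS s) \o act X gL = act X gL \o act X (gS s))%VF
}.

Section CentralFacts.
Variable X : rep A.
Hypothesis X_central : central X.

Lemma central_KKv v : act X gK (act X gK v) = v.
Proof. by rewrite -comp_lfunE (central_KK X_central) id_lfunE. Qed.

Lemma central_LLv v : act X gL (act X gL v) = v.
Proof. by rewrite -comp_lfunE (central_LL X_central) id_lfunE. Qed.

Lemma central_Ev v : act X gE v = 0.
Proof. by rewrite (central_E X_central) zero_lfunE. Qed.

Lemma central_Fv v : act X gF v = 0.
Proof. by rewrite (central_F X_central) zero_lfunE. Qed.

Lemma central_Zv e l v : act X (gZ e l) v = 0.
Proof. by rewrite (central_Z X_central) zero_lfunE. Qed.

(** The relation for [E, F] survives E = F = 0 because K^2 = 1 gives K = K^-1. *)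
Lemma central_module : is_module X.
Proof.
have K' v : iter r'.-1 (act X gK) v = act X gK v.
  exact: iter_half_pred _ central_KKv.
have r'_gt0 := half_r_gt0 r_div8 q_root.
apply: (@A_relations_module _ _ _ _ _ _ (fun=> True)) => [f g fg|].
  by apply/lfunP=> v; exact: fg.
have Ev := central_Ev; have Fv := central_Fv; have Zv := central_Zv.
split=> //.
- by move=> v _; rewrite -(quarter_rE r_div8) iter_involutive //; exact: central_KKv.
- by case: r' r'_gt0 => // n _ v _ /=; rewrite Ev.
- by case: r' r'_gt0 => // n _ v _ /=; rewrite Fv.
- by move=> v _; rewrite !Ev linear0 scaler0.
- by move=> v _; rewrite !Fv linear0 scaler0.
- by move=> v _; rewrite K' Ev Fv !subrr scaler0.
- by move=> v _; exact: central_LLv.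
- by move=> e l v _; rewrite !Zv linear0 oppr0.
- by move=> e l e' l' v _; rewrite !Zv oppr0.
- by move=> v _; rewrite -!comp_lfunE (central_LK X_central).
- by move=> v _; rewrite !Ev linear0.
- by move=> v _; rewrite !Fv linear0.
- by move=> e l v _; rewrite !Zv linear0 oppr0.
- by move=> e l v _; rewrite !Zv linear0 oppr0.
- by move=> e l v _; rewrite !Zv linear0.
- by move=> v _; rewrite (central_S1 X_central) id_lfunE.
- by move=> s t v _; rewrite -comp_lfunE (central_SS X_central).
- by move=> s v _; rewrite !Ev linear0.
- by move=> s v _; rewrite !Fv linear0.
- by move=> s v _; rewrite -!comp_lfunE (central_SK X_central).
- by move=> s v _; rewrite -!comp_lfunE (central_SL X_central).
- by move=> s e l v _; rewrite !Zv linear0.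
Qed.

Lemma central_Rmat_left W x w (s t : bool) :
  act X gK x = (-1) ^+ s *: x -> act X gL x = (-1) ^+ t *: x ->
  eval (act2 X W) (Rmat A) (tpure x w) =
  tpure x (iter t (act W gL) (iter (s * r'') (act W gK) w)).
Proof.
move=> xs xt; apply: eval_Rmat.
- by rewrite eval_R_alpha_left ?id_lfunE //; exact: central_Z X_central.
- by rewrite eval_R_Theta3 ?central_Ev ?tpure0l ?scaler0 ?addr0 //;
    left; rewrite /= !central_Ev.
- apply: (@eval_R_D_left _ _ _ _ _ r_div8 q_root _ _ _ _ (s * r'')).
    exact: mul_bool_quarter_lt.
  by rewrite xs; case: (s); rewrite ?mul0n ?muln0 ?expr0 // mul1n q_half.
- by rewrite (eval_R_z_left _ xt) eval_exp_var.
Qed.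

(** D and [R_z] are symmetric in their two legs, so [W] receives the same operator as in
    [central_Rmat_left]. *)
Lemma central_Rmat_right W x w (s t : bool) :
  act X gK x = (-1) ^+ s *: x -> act X gL x = (-1) ^+ t *: x ->
  eval (act2 W X) (Rmat A) (tpure w x) =
  tpure (iter t (act W gL) (iter (s * r'') (act W gK) w)) x.
Proof.
move=> xs xt; apply: eval_Rmat.
- by rewrite eval_R_alpha_right ?id_lfunE //; exact: central_Z X_central.
- by rewrite eval_R_Theta3 ?central_Fv ?tpure0r ?scaler0 ?addr0 //;
    right; rewrite /= !central_Fv.
- apply: (@eval_R_D_right _ _ _ _ _ r_div8 q_root _ _ _ _ (s * r'')).
    exact: mul_bool_quarter_lt.
  by rewrite xs; case: (s); rewrite ?mul0n ?muln0 ?expr0 // mul1n q_half.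
- by rewrite (eval_R_z_right _ xt) eval_exp_var.
Qed.

(** K and L are commuting involutions and 2 is invertible, so joint eigenvectors span [X] and an
    additive property need only be checked on them. *)
Lemma central_ind (P : space X -> Prop) :
    (forall u v, P u -> P v -> P (u + v)) ->
    (forall (s t : bool) x, act X gK x = (-1) ^+ s *: x ->
       act X gL x = (-1) ^+ t *: x -> P x) ->
  forall x, P x.
Proof.
move=> PD Peig; have two := two_neq0 r_div8 q_root.
have LK u : act X gL (act X gK u) = act X gK (act X gL u).
  by rewrite -!comp_lfunE (central_LK X_central).
have part_sum (f : 'End(space X)) u : u = 2%:R^-1 *: (u + (-1) ^+ false *: f u)
    + 2%:R^-1 *: (u + (-1) ^+ true *: f u).
  rewrite -scalerDr expr0 expr1 scale1r scaleN1r addrACA subrr addr0.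
  by rewrite -mulr2n -scaler_nat scalerA mulVf ?scale1r.
have part_eig (f : 'End(space X)) (s : bool) u : f (f u) = u ->
    f (2%:R^-1 *: (u + (-1) ^+ s *: f u)) =
    (-1) ^+ s *: (2%:R^-1 *: (u + (-1) ^+ s *: f u)).
  move=> ffu; rewrite linearZ /= linearD linearZ /= ffu scalerA mulrC -scalerA.
  by congr (_ *: _); rewrite scalerDr scalerA -signr_addb addbb scale1r addrC.
(* The projections for K preserve the eigenspaces of L, since K and L commute. *)
have part_comm (s t : bool) u : act X gL u = (-1) ^+ t *: u ->
    act X gL (2%:R^-1 *: (u + (-1) ^+ s *: act X gK u)) =
    (-1) ^+ t *: (2%:R^-1 *: (u + (-1) ^+ s *: act X gK u)).
  move=> ut; rewrite linearZ /= linearD linearZ /= LK ut linearZ /=.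
  rewrite [RHS]scalerA (mulrC ((-1) ^+ t)) -[RHS]scalerA; congr (_ *: _).
  by rewrite scalerDr !scalerA (mulrC ((-1) ^+ s)).
have PK (t : bool) u : act X gL u = (-1) ^+ t *: u -> P u.
  move=> ut; rewrite (part_sum (act X gK) u).
  by apply: (PD _ _); [apply: (Peig false t) | apply: (Peig true t)];
    by [exact: part_eig (central_KKv u) | exact: part_comm].
move=> u; rewrite (part_sum (act X gL) u).
by apply: (PD _ _); [apply: (PK false) | apply: (PK true)]; exact: part_eig (central_LLv u).
Qed.

End CentralFacts.

End CentralModules.

(** * Central modules are transparent and obey the sign rule *)

Section Centre.
Variables (k : fieldType) (p r : nat) (q : k) (alpha : 'I_p -> k).
Hypotheses (r_div8 : (8 %| r)%N) (q_root : r.-primitive_root q).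

Local Notation A := (A_alg r q alpha).
Local Notation r' := (r %/ 2)%N.
Local Notation r'' := (r %/ 4)%N.
Implicit Types X Y W : rep A.

Section ModuleFacts.
Variable X : rep A.
Hypothesis X_module : is_module X.

Lemma module_rel2 x y z w :
    A_rel r q (var k x * var k y) (var k z * var k w) ->
  (act X x \o act X y = act X z \o act X w)%VF.
Proof.
have ev2 u v : eval (@Defs.act k A X) (var k u * var k v) = (act X u \o act X v)%VF.
  by apply: etrans (evalM _ _ _) _; rewrite !eval_var.
by move=> rel; apply: etrans (esym (ev2 _ _)) (etrans (X_module rel) (ev2 _ _)).
Qed.

Lemma module_rel_exp1 x n v :
  A_rel r q (var k x ^+ n) 1 -> iter n (act X x) v = v.
Proof.
move=> rel; apply: etrans (esym (eval_exp_var _ _ _ _)) _.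
by rewrite (X_module rel) eval1 id_lfunE.
Qed.

Lemma module_LL : (act X gL \o act X gL)%VF = \1%VF.
Proof.
apply/lfunP=> v; rewrite comp_lfunE id_lfunE.
exact: (module_rel_exp1 v (A_LL _ _ _)).
Qed.

Lemma module_Kr v : iter r' (act X gK) v = v.
Proof. exact: module_rel_exp1 (A_Kr _ _ _). Qed.

Lemma module_S1 : act X (gS 1%g) = \1%VF.
Proof. by rewrite -eval_var (X_module (A_S1 _ _ _)) eval1. Qed.

Lemma module_SS s t : (act X (gS s) \o act X (gS t) = act X (gS (t * s)%g))%VF.
Proof.
have := X_module (A_SS _ _ s t); rewrite [RHS]eval_var => <-.
by apply/esym; apply: etrans (evalM _ _ _) _; rewrite !eval_var.
Qed.

End ModuleFacts.

(** On a joint eigenvector of [X] both braidings apply L^t K^(s r'') to [W], and its square is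
    L^(2t) K^(s r') = 1. *)
Lemma central_braidK X W : central X -> is_module W ->
  (rep_braid W X \o rep_braid X W)%VF = \1%VF.
Proof.
move=> Xc Wm.
have LK v : act W gL (act W gK v) = act W gK (act W gL v).
  by rewrite -!comp_lfunE (module_rel2 Wm (A_LK _ _ _)).
have LL v : act W gL (act W gL v) = v by rewrite -comp_lfunE module_LL ?id_lfunE.
have Kr := module_Kr Wm.
apply: tprod_ext => x w; rewrite id_lfunE.
move: x; apply: (central_ind r_div8 q_root Xc) => [u v Hu Hv|s t x xs xt].
  by rewrite tpureDl linearD /= Hu Hv.
have RXW (w' : space W) := central_Rmat_left r_div8 q_root Xc w' xs xt.
have RWX (w' : space W) := central_Rmat_right r_div8 q_root Xc w' xs xt.
apply: etrans (comp_lfunE _ _ _) _.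
have -> : rep_braid X W (tpure x w) =
    tpure (iter t (act W gL) (iter (s * r'') (act W gK) w)) x.
  by apply: etrans (comp_lfunE _ _ _) _; rewrite RXW tflipE.
apply: etrans (comp_lfunE _ _ _) _; rewrite RWX tflipE; congr tpure.
have Kiter n v : iter n (act W gK) (act W gL v) = act W gL (iter n (act W gK) v).
  by elim: n => //= n ->; rewrite LK.
have KK : iter (s * r'') (act W gK) (iter (s * r'') (act W gK) w) = w.
  case: (s); rewrite ?mul0n // mul1n -iterD.
  by rewrite addnn -muln2 (quarter_rE r_div8) Kr.
by case: (t) => /=; rewrite ?Kiter ?LL KK.
Qed.

Lemma central_transparent X : central X -> transparent (C := modcat A) X.
Proof. by move=> Xc W; exact: central_braidK. Qed.

(** Every term in the coproducts of E, F and Z has a leg that acts by zero, and so has E ⊗ E and the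
    like. *)
Lemma central_coprod X Y x : central X -> central Y ->
  eval (act2 X Y) (A_coprod k r x) = tmap (act X x) (act Y x).
Proof.
move=> Xc Yc.
have evp a b f g : eval (@Defs.act k A X) a = f -> eval (@Defs.act k A Y) b = g ->
    eval (act2 X Y) (pure2 a b) = tmap f g.
  by move=> <- <-; exact: eval_pure2.
have evpD a b f g : eval (act2 X Y) a = f -> eval (act2 X Y) b = g ->
    eval (act2 X Y) (a + b) = f + g.
  by move=> <- <-; exact: evalD.
have ev Z x' : eval (@Defs.act k A Z) (var k x') = act Z x' := eval_var _ _.
case: x => [||||e l|s].
- exact: evp (ev _ _) (ev _ _).
- apply: etrans (evpD _ _ _ _ (evp _ _ _ _ erefl (ev _ _)) (evp _ _ _ _ (ev _ _) erefl)) _.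
  by rewrite (central_E Xc) (central_E Yc) tmap0l !tmap0r addr0.
- apply: etrans (evpD _ _ _ _ (evp _ _ _ _ (ev _ _) erefl) (evp _ _ _ _ erefl (ev _ _))) _.
  by rewrite (central_F Xc) (central_F Yc) tmap0l !tmap0r addr0.
- exact: evp (ev _ _) (ev _ _).
- apply: etrans (evpD _ _ _ _ (evp _ _ _ _ erefl (ev _ _)) (evp _ _ _ _ (ev _ _) erefl)) _.
  by rewrite (central_Z Xc) (central_Z Yc) tmap0l !tmap0r addr0.
- exact: evp (ev _ _) (ev _ _).
Qed.

Lemma central_one : central (rep_one A).
Proof.
by split=> *; rewrite /= ?scale0r ?scale1r // -?comp_lfunZl ?comp_lfun1l.
Qed.

Lemma central_tens X Y : central X -> central Y -> central (rep_tens X Y).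
Proof.
move=> Xc Yc; have cp x : act (rep_tens X Y) x = tmap (act X x) (act Y x).
  exact: central_coprod.
split=> *; rewrite !cp.
- by rewrite (central_E Xc) tmap0l.
- by rewrite (central_F Xc) tmap0l.
- by rewrite (central_Z Xc) tmap0l.
- by rewrite -tmap_comp (central_KK Xc) (central_KK Yc) tmap1.
- by rewrite -tmap_comp (central_LL Xc) (central_LL Yc) tmap1.
- by rewrite -!tmap_comp (central_LK Xc) (central_LK Yc).
- by rewrite (central_S1 Xc) (central_S1 Yc) tmap1.
- by rewrite -tmap_comp (central_SS Xc) (central_SS Yc).
- by rewrite -!tmap_comp (central_SK Xc) (central_SK Yc).
- by rewrite -!tmap_comp (central_SL Xc) (central_SL Yc).
Qed.

Lemma central_Rmat X Y : central X -> central Y ->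
  eval (act2 X Y) (Rmat A) = 2%:R^-1 *:
    (tmap \1 \1 + tmap (act X gL) \1 + tmap \1 (act Y gL)
     - tmap (act X gL) (act Y gL))%VF.
Proof.
move=> Xc Yc; apply: tprod_ext => x y; move: x.
have two := two_neq0 r_div8 q_root.
apply: (central_ind r_div8 q_root Xc) => [u v Hu Hv|s t x xs xt].
  by rewrite tpureDl [LHS]linearD [RHS]linearD; congr (_ + _).
rewrite (central_Rmat_left r_div8 q_root Xc _ xs xt).
(* On the second central module K^r'' = 1, which removes the contribution of D and leaves that of
   [R_z]. *)
have -> : iter (s * r'') (act Y gK) y = y.
  case: (s); rewrite ?mul0n // mul1n (quarter_r_even r_div8) iter_involutive //.
  exact: central_KKv Yc.
rewrite scale_lfunE !(add_lfunE, opp_lfunE) !tmapE !id_lfunE xt.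
case: (t); rewrite ?expr0 ?expr1 ?scaleN1r ?scale1r.
  by rewrite !tpureNl opprK addrN add0r -mulr2n -scaler_nat scalerA mulVf ?scale1r.
by rewrite addrK -mulr2n -scaler_nat scalerA mulVf ?scale1r.
Qed.

Lemma central_super : @super_class k A gL (@central k p r q alpha).
Proof.
split.
- exact: central_one.
- exact: central_tens.
- move=> X [||||e l|s] Xc /=; rewrite ?scale1r //.
  + by rewrite (central_E Xc) scaler0.
  + by rewrite (central_F Xc) scaler0.
  + by rewrite (central_Z Xc) scaler0.
- by move=> X Y x; exact: central_coprod.
- exact: central_LL.
- move=> X [||||e l|s] Xc //.
  + exact: central_LK.
  + by rewrite (central_E Xc) comp_lfun0l comp_lfun0r.
  + by rewrite (central_F Xc) comp_lfun0l comp_lfun0r.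
  + by rewrite (central_Z Xc) comp_lfun0l comp_lfun0r.
  + by rewrite (central_SL Xc).
- exact: central_Rmat.
Qed.

End Centre.

(** * Two test modules *)

Section BasisSpace.
Variables (k : fieldType) (T : finType).
Local Notation V := {ffun T -> k^o}.

Definition bvec (t : T) : V := [ffun s => (s == t)%:R].

Definition bmap (W : lmodType k) (f : T -> W) (v : V) : W := \sum_t v t *: f t.

Lemma bmap_is_linear (W : lmodType k) (f : T -> W) : linear (bmap f).
Proof.
move=> c u v; rewrite scaler_sumr -big_split; apply: eq_bigr => t _ /=.
by rewrite !ffunE scalerDl scalerA.
Qed.

HB.instance Definition _ (W : lmodType k) (f : T -> W) :=
  GRing.isLinear.Build k V W _ (bmap f) (bmap_is_linear f).

Definition bop (W : vectType k) (f : T -> W) : 'Hom(V, W) := linfun (bmap f).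

Lemma bopE (W : vectType k) (f : T -> W) t : bop f (bvec t) = f t.
Proof.
rewrite lfunE /= /bmap (bigD1 t) //= big1 ?addr0 => [|s neq_st].
  by rewrite ffunE eqxx scale1r.
by rewrite ffunE (negPf neq_st) scale0r.
Qed.

(** Phrased so as to match the spanning condition of [A_relations_module]. *)
Lemma bvec_span (W : vectType k) (f g : 'Hom(V, W)) :
  (forall v, (exists t, v = bvec t) -> f v = g v) -> f = g.
Proof.
move=> fg; apply/lfunP=> v; have -> : v = \sum_t v t *: bvec t.
  apply/ffunP=> s; rewrite sum_ffunE (bigD1 s) //= big1 ?addr0 => [|t neq_ts].
    by rewrite !ffunE eqxx; exact: esym (mulr1 _).
  by rewrite !ffunE eq_sym (negPf neq_ts); exact: mulr0.
rewrite !linear_sum; apply: eq_bigr => t _; rewrite !linearZ /=.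
by rewrite fg //; exists t.
Qed.

(** The coordinate at [t] in the second factor; it reads off coefficients from the identities that
    transparency gives. *)
Definition slice (U : vectType k) (t : T) : 'Hom(tprod U V, U) :=
  tlift (fun u (v : V) => (v t : k) *: u).

Lemma sliceE (U : vectType k) t (u : U) (v : V) :
  slice U t (tpure u v) = (v t : k) *: u.
Proof.
rewrite tliftE // => [{}v|{}u] c x y.
  by rewrite scalerDr !scalerA mulrC.
by rewrite !ffunE scalerDl scalerA.
Qed.

Lemma slice_bvec (U : vectType k) t s (u : U) :
  slice U t (tpure u (bvec s)) = if t == s then u else 0.
Proof. by rewrite sliceE ffunE; case: eqP; rewrite (scale1r, scale0r). Qed.

End BasisSpace.

Section TestModules.
Variables (k : fieldType) (p r : nat) (q : k) (alpha : 'I_p -> k).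
Hypotheses (r_div8 : (8 %| r)%N) (q_root : r.-primitive_root q).

Local Notation A := (A_alg r q alpha).
Local Notation r' := (r %/ 2)%N.
Local Notation r'' := (r %/ 4)%N.

(* The three-dimensional simple module of highest weight q^2, with basis
   [Some true], [None], [Some false] by decreasing weight. *)
Definition triplet_weight (t : option bool) : nat :=
  match t with Some true => 1%N | None => 0%N | Some false => r'.-1 end.

(** With F normalised to coefficient 1, the commutator [E, F] forces the coefficient [2] = q + q^-1
    of E. *)
Definition triplet_act (x : A_gen p) : 'End({ffun option bool -> k^o}) :=
  match x with
  | gK => bop (fun t => q ^+ (2 * triplet_weight t) *: bvec k t)
  | gE => bop (fun t => match t with
                        | Some true => 0
                        | None => (q + q^-1) *: bvec k (Some true)
                        | Some false => (q + q^-1) *: bvec k None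
                        end)
  | gF => bop (fun t => match t with
                        | Some true => bvec k None
                        | None => bvec k (Some false)
                        | Some false => 0
                        end)
  | gZ _ _ => 0
  | gL | gS _ => \1%VF
  end.

Definition triplet : rep A := @Rep k A {ffun option bool -> k^o} triplet_act.

Lemma q_weight t : (q ^+ (2 * triplet_weight t)) ^+ r' = 1.
Proof. by rewrite [q ^+ _]exprM exprAC (prim_expr_order (q2_root r_div8 q_root)) expr1n. Qed.

Lemma triplet_K t :
  act triplet gK (bvec k t) = q ^+ (2 * triplet_weight t) *: bvec k t.
Proof. exact: bopE. Qed.

Lemma iter_triplet_K n t :
  iter n (act triplet gK) (bvec k t) = (q ^+ (2 * triplet_weight t)) ^+ n *: bvec k t.
Proof.
elim: n => [|n IHn]; first by rewrite scale1r.
by rewrite iterS IHn linearZ /= -/(act triplet gK) triplet_K scalerA exprSr.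
Qed.

Lemma q_neq_qV : q - q^-1 != 0.
Proof.
have q0 := q_neq0 q_root.
rewrite subr_eq0; apply/negP=> /eqP qV.
have : (r' %| 1)%N.
  by rewrite (prim_order_dvd (q2_root r_div8 q_root)) expr1 expr2 {1}qV mulVf.
by rewrite dvdn1 => /eqP r1; have := half_r_ge4 r_div8 q_root; rewrite r1.
Qed.

Lemma q_pred_half : q ^+ (2 * r'.-1) = q ^- 2.
Proof.
have q0 := q_neq0 q_root.
apply: (mulfI (expf_neq0 2 q0)); rewrite divff ?expf_neq0 // -exprD -mulnS.
rewrite prednK ?(half_r_gt0 r_div8 q_root) // mulnC half_rE //.
exact: prim_expr_order q_root.
Qed.

Lemma q_weight_inv t : (q ^+ (2 * triplet_weight t)) ^+ r'.-1 =
  (q ^+ (2 * triplet_weight t))^-1.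
Proof.
have q0 : q ^+ (2 * triplet_weight t) != 0.
  by rewrite expf_neq0 // (q_neq0 q_root).
apply: (mulfI q0); rewrite divff // -exprS prednK ?q_weight //.
exact: half_r_gt0 r_div8 q_root.
Qed.

Lemma triplet_module : is_module triplet.
Proof.
have q0 := q_neq0 q_root; have qV := q_neq_qV.
have r4 := half_r_ge4 r_div8 q_root; have qp := q_pred_half.
have K t : act triplet gK (bvec k t) = q ^+ (2 * triplet_weight t) *: bvec k t.
  exact: bopE.
have E t : act triplet gE (bvec k t) = match t with
    | Some true => 0
    | None => (q + q^-1) *: bvec k (Some true)
    | Some false => (q + q^-1) *: bvec k None end by exact: bopE.
have F t : act triplet gF (bvec k t) = match t with
    | Some true => bvec k None
    | None => bvec k (Some false)
    | Some false => 0 end by exact: bopE.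
have L v : act triplet gL v = v by exact: id_lfunE.
have S s v : act triplet (gS s) v = v by exact: id_lfunE.
have Z e l v : act triplet (gZ e l) v = 0 by exact: zero_lfunE.
have iter0 (f : 'End(space triplet)) v : f (f (f v)) = 0 -> iter r' f v = 0.
  rewrite -[f (f (f v))]/(iter 3 f v) => f3; have /subnK <- : (3 <= r')%N by exact: ltnW.
  by rewrite iterD f3; elim: (r' - 3)%N => //= m ->; rewrite linear0.
have lin0 (f : 'End(space triplet)) : f 0 = 0 by exact: linear0.
have linZ (f : 'End(space triplet)) c v : f (c *: v) = c *: f v by rewrite linearZ.
(* This is [2] = {2}/{1}, the value of (K - K^-1)/(q - q^-1) on the highest weight vector. *)
have q2 : (q - q^-1)^-1 * (q ^+ 2 - q ^- 2) = q + q^-1.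
  by rewrite -exprVn subr_sqr mulKf.
apply: (@A_relations_module k p r q alpha triplet (fun v => exists t, v = bvec k t)).
  exact: bvec_span.
split.
- by move=> _ [t ->]; rewrite iter_triplet_K q_weight scale1r.
- by move=> _ [[[]|] ->]; apply: iter0; rewrite !(E, lin0, linZ, scaler0).
- by move=> _ [[[]|] ->]; apply: iter0; rewrite !(F, lin0).
- move=> _ [t ->]; rewrite iter_triplet_K q_weight_inv linZ E.
  case: t => [[]|]; rewrite ?scaler0 ?lin0 ?scaler0 //.
    rewrite /triplet_weight !linZ K !scalerA qp invrK.
    by rewrite /triplet_weight muln0 expr0 mulr1.
  rewrite /triplet_weight !linZ K !scalerA.
  by rewrite /triplet_weight muln0 expr0 invr1 mul1r mulrC.
- move=> _ [t ->]; rewrite iter_triplet_K q_weight_inv linZ F.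
  case: t => [[]|]; rewrite ?scaler0 ?lin0 ?scaler0 //.
    rewrite /triplet_weight linZ K !scalerA.
    by rewrite /triplet_weight muln0 expr0 mulr1 muln1.
  rewrite /triplet_weight linZ K !scalerA.
  by rewrite /triplet_weight muln0 expr0 invr1 mul1r qp.
- move=> _ [t ->]; rewrite K iter_triplet_K q_weight_inv -scalerBl scalerA E F.
  case: t => [[]|].
  + by rewrite E lin0 subr0 /triplet_weight muln1 q2.
  + rewrite lin0 sub0r linZ F -scaleNr -q2 /triplet_weight qp invrK.
    by rewrite -mulrN opprB.
  + rewrite E linZ F subrr /triplet_weight muln0 expr0 invr1 subrr mulr0.
    by rewrite scale0r.
- by move=> v _; rewrite !L.
- by move=> e l v _; rewrite !Z lin0 oppr0.
- by move=> e l e' l' v _; rewrite !Z oppr0.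
- by move=> e l v _; rewrite !Z.
- by move=> v _; rewrite !L.
- by move=> v _; rewrite !L.
- by move=> v _; rewrite !L.
- by move=> e l v _; rewrite !Z lin0 oppr0.
- by move=> e l v _; rewrite !Z lin0 oppr0.
- by move=> e l v _; rewrite !Z lin0.
- by move=> v _; rewrite !S.
- by move=> s t v _; rewrite !S.
- by move=> s v _; rewrite !S.
- by move=> s v _; rewrite !S.
- by move=> s v _; rewrite !S.
- by move=> s v _; rewrite !S.
- by move=> s e l v _; rewrite !S !Z.
Qed.

(* The quotient of the exterior algebra on the [Z e l], for a fixed sign [e], by
   the products of two generators; [K] and [L] both act as the parity. *)
Definition odd_vac_act (e : bool) (x : A_gen p) :
    'End({ffun option 'I_p -> k^o}) :=
  match x with
  | gK | gL => bop (fun t => (-1) ^+ (t != None) *: bvec k t)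
  | gE | gF => 0
  | gZ e' l => if e' == e then
      bop (fun t => if t == None then bvec k (Some l) else 0) else 0
  | gS s => bop (fun t => bvec k (omap s t))
  end.

Definition odd_vac e : rep A := @Rep k A {ffun option 'I_p -> k^o} (odd_vac_act e).

Section OddVac.
Variable e : bool.

Lemma odd_vac_K t : act (odd_vac e) gK (bvec k t) = (-1) ^+ (t != None) *: bvec k t.
Proof. exact: bopE. Qed.

Lemma odd_vac_L t : act (odd_vac e) gL (bvec k t) = (-1) ^+ (t != None) *: bvec k t.
Proof. exact: bopE. Qed.

Lemma odd_vac_Z e' l t : act (odd_vac e) (gZ e' l) (bvec k t) =
  if (e' == e) && (t == None) then bvec k (Some l) else 0.
Proof. by rewrite /=; case: (e' == e); rewrite ?bopE ?zero_lfunE. Qed.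

Lemma odd_vac_ZZ e1 l1 e2 l2 :
  (act (odd_vac e) (gZ e1 l1) \o act (odd_vac e) (gZ e2 l2) = 0)%VF.
Proof.
apply: bvec_span => _ [t ->]; rewrite comp_lfunE zero_lfunE odd_vac_Z.
by case: ifP => _; rewrite ?linear0 // odd_vac_Z andbF.
Qed.

Lemma odd_vac_KK : (act (odd_vac e) gK \o act (odd_vac e) gK = \1)%VF.
Proof.
apply: bvec_span => _ [t ->]; rewrite comp_lfunE id_lfunE odd_vac_K.
rewrite linearZ /= -/(act (odd_vac e) gK) odd_vac_K scalerA.
by rewrite -signr_addb addbb scale1r.
Qed.

Lemma odd_vac_module : is_module (odd_vac e).
Proof.
have K := odd_vac_K; have L := odd_vac_L; have Z := odd_vac_Z.
have S s t : act (odd_vac e) (gS s) (bvec k t) = bvec k (omap s t) by exact: bopE.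
have E v : act (odd_vac e) gE v = 0 by exact: zero_lfunE.
have F v : act (odd_vac e) gF v = 0 by exact: zero_lfunE.
have lin0 (f : 'End(space (odd_vac e))) : f 0 = 0 by exact: linear0.
have linZ (f : 'End(space (odd_vac e))) c v : f (c *: v) = c *: f v by rewrite linearZ.
have KK : involutive (act (odd_vac e) gK).
  by move=> v; rewrite -comp_lfunE odd_vac_KK id_lfunE.
have r'_gt0 := half_r_gt0 r_div8 q_root.
have signK (b : bool) : ((-1) ^+ b * (-1) ^+ b : k) = 1.
  by rewrite -signr_addb addbb.
have ZZ e1 l1 e2 l2 v : act (odd_vac e) (gZ e1 l1) (act (odd_vac e) (gZ e2 l2) v) = 0.
  by rewrite -comp_lfunE odd_vac_ZZ zero_lfunE.
(* K and L act by the same parity operator, so one anticommutation argument serves both relations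
   with Z. *)
have ZN f e' l t :
    (forall t, act (odd_vac e) f (bvec k t) = (-1) ^+ (t != None) *: bvec k t) ->
    act (odd_vac e) f (act (odd_vac e) (gZ e' l) (bvec k t)) =
    - act (odd_vac e) (gZ e' l) (act (odd_vac e) f (bvec k t)).
  move=> fE; rewrite fE linZ Z; case: ifP => [/andP[_ /eqP->]|_].
    by rewrite fE expr0 expr1 scale1r scaleN1r.
  by rewrite lin0 scaler0 oppr0.
apply: (@A_relations_module k p r q alpha (odd_vac e) (fun v => exists t, v = bvec k t)).
  exact: bvec_span.
split.
- by move=> v _; rewrite -(quarter_rE r_div8) iter_involutive.
- by case: r' r'_gt0 => // n _ v _; rewrite iterS E.
- by case: r' r'_gt0 => // n _ v _; rewrite iterS F.
- by move=> v _; rewrite !E lin0 scaler0.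
- by move=> v _; rewrite !F lin0 scaler0.
- move=> v _; rewrite !E ?F subrr (iter_half_pred r_div8 q_root _ KK).
  by rewrite subrr scaler0.
- by move=> _ [t ->]; rewrite L linZ L scalerA signK scale1r.
- by move=> e' l _ [t ->]; exact: ZN.
- by move=> e1 l1 e2 l2 v _; rewrite !ZZ oppr0.
- by move=> e' l v _; rewrite ZZ.
- by [].
- by move=> v _; rewrite !E lin0.
- by move=> v _; rewrite !F lin0.
- by move=> e' l _ [t ->]; exact: ZN.
- by move=> e' l v _; rewrite !E lin0 oppr0.
- by move=> e' l v _; rewrite !F lin0.
- by move=> _ [t ->]; rewrite S; case: t => //= l; rewrite perm1.
- by move=> s t _ [u ->]; rewrite !S; case: u => //= l; rewrite permM.
- by move=> s v _; rewrite !E lin0.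
- by move=> s v _; rewrite !F lin0.
- by move=> s _ [t ->]; rewrite S !K linZ S; case: t.
- by move=> s _ [t ->]; rewrite S !L linZ S; case: t.
- move=> s e' l _ [t ->]; rewrite S !Z; case: t => [t|] /=.
    by rewrite !andbF lin0.
  by rewrite !andbT; case: ifP; rewrite ?S ?lin0.
Qed.

End OddVac.

End TestModules.

(** * Transparent modules are central *)

Lemma sum_bool_pair (V : nmodType) (T : finType) (b : bool) (F : bool * T -> V) :
  (forall t, F (~~ b, t) = 0) -> \sum_i F i = \sum_t F (b, t).
Proof.
move=> F0; transitivity (\sum_c \sum_t F (c, t)).
  by rewrite pair_bigA; apply: eq_bigr => -[].
rewrite (bigD1 b) //= [X in _ + X]big1 ?addr0 // => c neq_cb.
by rewrite big1 // => t _; have -> : c = ~~ b by case: (c) (b) neq_cb => [] [].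
Qed.

Section Detection.
Variables (k : fieldType) (p r : nat) (q : k) (alpha : 'I_p -> k).
Hypotheses (r_div8 : (8 %| r)%N) (q_root : r.-primitive_root q).

Local Notation A := (A_alg r q alpha).
Local Notation r' := (r %/ 2)%N.
Local Notation r'' := (r %/ 4)%N.
Implicit Types X Y : rep A.

(** The coefficient is q - q^-1. *)
Lemma Theta_coef1_neq0 : Theta_coef q 1 != 0.
Proof.
have qV := q_neq_qV r_div8 q_root.
rewrite /Theta_coef /qfact big_nat1 /qint /qbrace !expr1 divff // divr1.
by rewrite mulf_neq0 // expf_neq0 // (q_neq0 q_root).
Qed.

(** Otherwise q^2 = -1 and q^4 = 1, but q^2 has order r' >= 4. *)
Lemma q_addV_neq0 : q + q^-1 != 0.
Proof.
have q0 := q_neq0 q_root.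
apply/negP=> /eqP q2; have : (q ^+ 2) ^+ 2 = 1.
  have -> : q ^+ 2 = -1 by rewrite expr2 -{1}(addr0_eq (etrans (addrC _ _) q2)) mulNr mulVf.
  by rewrite sqrrN expr1n.
move/eqP; rewrite -(prim_order_dvd (q2_root r_div8 q_root)) => /dvdn_leq-/(_ isT).
by rewrite leqNgt (leq_trans _ (half_r_ge4 r_div8 q_root)).
Qed.

(** * Transparency against the three-dimensional module *)

Section Triplet.
Variable X : rep A.
Hypothesis X_module : is_module X.
Local Notation Y := (triplet r q alpha).
Hypothesis XY_trivial : (rep_braid Y X \o rep_braid X Y = \1)%VF.

Local Notation top := (bvec k (Some true)).
Local Notation mid := (bvec k (None : option bool)).
Local Notation low := (bvec k (Some false)).
Local Notation K' := (iter r'.-1 (act X gK)).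

Lemma triplet_weight_lt t : (triplet_weight r t < r')%N.
Proof.
have r4 := half_r_ge4 r_div8 q_root.
by case: t => [[]|]; rewrite /triplet_weight ?prednK //; exact: leq_trans r4.
Qed.

Lemma triplet_Kinv v : K' (act X gK v) = v.
Proof.
rewrite -iterSr prednK ?(half_r_gt0 r_div8 q_root) //.
exact: module_Kr X_module _.
Qed.

(** Since Z = 0 and L = 1 on the triplet, [R_alpha] and [R_z] act as the identity. *)
Lemma Rmat_right_triplet x t u :
    eval (act2 X Y) (R_Theta p r q) (tpure x (bvec k t)) = u ->
  eval (act2 X Y) (Rmat A) (tpure x (bvec k t)) =
  eval (act2 X Y) (R_D p r q) u.
Proof.
move=> Theta_u.
apply: (@eval_Rmat k p r q alpha X Y _ (tpure x (bvec k t)) u _ _ _ Theta_u) => //.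
  by rewrite eval_R_alpha_right // id_lfunE.
have Rz1 v : eval (act2 X Y) (R_z k p) v = v; last exact: Rz1.
suff -> : eval (act2 X Y) (R_z k p) = \1%VF by rewrite id_lfunE.
apply: tprod_ext => x' y'; rewrite id_lfunE.
by rewrite (@eval_R_z_right _ _ _ _ _ r_div8 q_root _ _ _ _ false) //= id_lfunE scale1r.
Qed.

Lemma Rmat_left_triplet x t u :
    eval (act2 Y X) (R_Theta p r q) (tpure (bvec k t) x) = u ->
  eval (act2 Y X) (Rmat A) (tpure (bvec k t) x) =
  eval (act2 Y X) (R_D p r q) u.
Proof.
move=> Theta_u.
apply: (@eval_Rmat k p r q alpha Y X _ (tpure (bvec k t) x) u _ _ _ Theta_u) => //.
  by rewrite eval_R_alpha_left // id_lfunE.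
have Rz1 v : eval (act2 Y X) (R_z k p) v = v; last exact: Rz1.
suff -> : eval (act2 Y X) (R_z k p) = \1%VF by rewrite id_lfunE.
apply: tprod_ext => x' y'; rewrite id_lfunE.
by rewrite (@eval_R_z_left _ _ _ _ _ r_div8 q_root _ _ _ _ false) //= id_lfunE scale1r.
Qed.

Lemma R_D_right_triplet x t :
  eval (act2 X Y) (R_D p r q) (tpure x (bvec k t)) =
  tpure (iter (triplet_weight r t) (act X gK) x) (bvec k t).
Proof.
rewrite (eval_R_D_right r_div8 q_root _ (triplet_weight_lt t)) ?eval_exp_var //.
exact: triplet_K.
Qed.

Lemma R_D_left_triplet x t :
  eval (act2 Y X) (R_D p r q) (tpure (bvec k t) x) =
  tpure (bvec k t) (iter (triplet_weight r t) (act X gK) x).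
Proof.
rewrite (eval_R_D_left r_div8 q_root _ (triplet_weight_lt t)) ?eval_exp_var //.
exact: triplet_K.
Qed.

Lemma triplet_E t : act Y gE (bvec k t) = match t with
    | Some true => 0
    | None => (q + q^-1) *: top
    | Some false => (q + q^-1) *: mid end.
Proof. exact: bopE. Qed.

Lemma triplet_F t : act Y gF (bvec k t) = match t with
    | Some true => mid
    | None => low
    | Some false => 0 end.
Proof. exact: bopE. Qed.

(** F kills the lowest vector, so Theta reduces to its term a = 0 and D applies K^-1 to [x]. *)
Lemma braid_low x : rep_braid X Y (tpure x low) = tpure low (K' x).
Proof.
apply: etrans (comp_lfunE _ _ _) _.
have -> : eval (act2 X Y) (Rmat A) (tpure x low) = tpure (K' x) low; last by rewrite tflipE.
rewrite (Rmat_right_triplet (u := tpure x low)) ?R_D_right_triplet //.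
have F0 : act Y gF 0 = 0 by exact: linear0.
rewrite (eval_R_Theta3 r_div8 q_root); last by right; rewrite !iterS triplet_F !F0.
by rewrite triplet_F F0 !tpure0r !scaler0 !addr0.
Qed.

(** Now E raises the lowest vector, each step giving a factor [2], and all three terms of Theta
    appear; D then applies K^-1, 1 and K to them. *)
Lemma braid_low' y : rep_braid Y X (tpure low y) =
  tpure (K' y) low + (Theta_coef q 1 * (q + q^-1)) *: tpure (act X gF y) mid
  + (Theta_coef q 2 * (q + q^-1) ^+ 2) *: tpure (act X gK (act X gF (act X gF y))) top.
Proof.
apply: etrans (comp_lfunE _ _ _) _.
have E0 : act Y gE 0 = 0 by exact: linear0.
have EZ c v : act Y gE (c *: v) = c *: act Y gE v by rewrite linearZ.
rewrite (Rmat_left_triplet (u := tpure low y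
  + (Theta_coef q 1 * (q + q^-1)) *: tpure mid (act X gF y)
  + (Theta_coef q 2 * (q + q^-1) ^+ 2) *: tpure top (act X gF (act X gF y)))).
  rewrite [X in tflip _ _ X]linearD [X in tflip _ _ (X + _)]linearD.
  rewrite [X in tflip _ _ (_ + X + _)]linearZ [X in tflip _ _ (_ + X)]linearZ /=.
  rewrite !R_D_left_triplet.
  by rewrite !linearD !linearZ /= !tflipE.
rewrite (eval_R_Theta3 r_div8 q_root); last first.
  by left; rewrite !iterS triplet_E EZ triplet_E EZ EZ triplet_E !scaler0.
by rewrite triplet_E EZ triplet_E !tpureZl !scalerA expr2 mulrA.
Qed.

(** Transparency with both braidings expanded: the coefficient of [low] yields K^2 = 1, that of
    [mid] yields F = 0. *)
Lemma triplet_low x : tpure x low =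
  tpure (K' (K' x)) low + (Theta_coef q 1 * (q + q^-1)) *: tpure (act X gF (K' x)) mid
  + (Theta_coef q 2 * (q + q^-1) ^+ 2) *: tpure (act X gK (act X gF (act X gF (K' x)))) top.
Proof.
rewrite -braid_low' -braid_low; apply: esym.
by apply: etrans (esym (comp_lfunE _ _ _)) _; rewrite XY_trivial id_lfunE.
Qed.

Lemma triplet_KK v : act X gK (act X gK v) = v.
Proof.
have K'K' x : K' (K' x) = x.
  have := congr1 (slice (space X) (Some false)) (triplet_low x).
  by rewrite !linearD !linearZ /= !slice_bvec /= !scaler0 !addr0.
have KK' x : act X gK (K' x) = x.
  rewrite -iterS prednK ?(half_r_gt0 r_div8 q_root) //.
  exact: module_Kr X_module _.
by rewrite -{1}[v]K'K' !KK'.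
Qed.

Lemma triplet_F0 : act X gF = 0.
Proof.
apply/lfunP=> v; rewrite zero_lfunE.
have := congr1 (slice (space X) None) (triplet_low (act X gK v)).
rewrite !linearD !linearZ /= !slice_bvec /= !scaler0 add0r addr0 triplet_Kinv.
move/esym/eqP; rewrite scaler_eq0 mulf_eq0 (negPf Theta_coef1_neq0) /=.
by rewrite (negPf q_addV_neq0) => /eqP.
Qed.

Lemma braid_mid x : rep_braid X Y (tpure x mid) =
  tpure mid x + Theta_coef q 1 *: tpure low (K' (act X gE x)).
Proof.
apply: etrans (comp_lfunE _ _ _) _.
have F0 : act Y gF 0 = 0 by exact: linear0.
rewrite (Rmat_right_triplet (u := tpure x mid
    + Theta_coef q 1 *: tpure (act X gE x) low)).
  rewrite [X in tflip _ _ X]linearD [X in tflip _ _ (_ + X)]linearZ /=.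
  by rewrite !R_D_right_triplet linearD linearZ /= !tflipE.
rewrite (eval_R_Theta3 r_div8 q_root); last by right; rewrite !iterS !triplet_F !F0.
by rewrite !triplet_F tpure0r scaler0 addr0.
Qed.

Lemma braid_left_F0 t x : rep_braid Y X (tpure (bvec k t) x) =
  tpure (iter (triplet_weight r t) (act X gK) x) (bvec k t).
Proof.
apply: etrans (comp_lfunE _ _ _) _.
rewrite (Rmat_left_triplet (u := tpure (bvec k t) x)) ?R_D_left_triplet ?tflipE //.
rewrite (eval_R_Theta3 r_div8 q_root) triplet_F0 ?zero_lfunE; last first.
  by right; rewrite !iterS zero_lfunE.
by rewrite !tpure0r !scaler0 !addr0.
Qed.

(** F^2 kills [mid], so the first braiding adds only the term in E x. Once F = 0, the second
    braiding is diagonal, and the coefficient of [low] becomes (q - q^-1) K^-2 E x with K^2 = 1. *)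
Lemma triplet_E0 : act X gE = 0.
Proof.
apply/lfunP=> x; rewrite zero_lfunE.
have : rep_braid Y X (rep_braid X Y (tpure x mid)) = tpure x mid.
  by apply: etrans (esym (comp_lfunE _ _ _)) _; rewrite XY_trivial id_lfunE.
rewrite braid_mid linearD linearZ /= !braid_left_F0 /=.
move/(congr1 (slice (space X) (Some false))).
rewrite linearD linearZ /= !slice_bvec /= add0r => /eqP.
have K'E := iter_half_pred r_div8 q_root _ triplet_KK.
by rewrite scaler_eq0 (negPf Theta_coef1_neq0) !K'E triplet_KK => /eqP.
Qed.

End Triplet.

(** * Transparency against the truncated exterior algebra *)

Section OddVac.
Variables (X : rep A) (e : bool).
Local Notation Y := (odd_vac r q alpha e).
Hypotheses (X_E : act X gE = 0) (X_F : act X gF = 0).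
Hypothesis X_KK : (act X gK \o act X gK = \1)%VF.
Hypothesis X_LL : (act X gL \o act X gL = \1)%VF.
Hypothesis XY_trivial : (rep_braid Y X \o rep_braid X Y = \1)%VF.

Local Notation vac := (bvec k (None : option 'I_p)).
Local Notation odd l := (bvec k (Some l)).

Lemma eval_LbarZ (W : rep A) e' l w :
  eval (@Defs.act k A W) (var k gK ^+ r'' * var k gL * var k (gZ e' l)) w =
  iter r'' (act W gK) (act W gL (act W (gZ e' l) w)).
Proof.
have evM a b v : eval (@Defs.act k A W) (a * b) v =
    eval (@Defs.act k A W) a (eval (@Defs.act k A W) b v).
  by rewrite -comp_lfunE; congr (fun_of_lfun _ v); exact: evalM.
by apply: etrans (evM _ _ _) (etrans (evM _ _ _) _); rewrite !eval_var eval_exp_var.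
Qed.

Lemma iter_quarter (W : rep A) w : (act W gK \o act W gK = \1)%VF -> iter r'' (act W gK) w = w.
Proof.
move=> KK; rewrite (quarter_r_even r_div8) iter_involutive // => v.
by rewrite -comp_lfunE KK id_lfunE.
Qed.

Lemma odd_vac_weight t :
  act Y gK (bvec k t) = q ^+ (2 * ((t != None) * r'')) *: bvec k t.
Proof.
rewrite odd_vac_K; congr (_ *: _); case: (t != None); rewrite ?mul0n ?muln0 //.
by rewrite mul1n q_half.
Qed.

(** Theta is trivial because E = 0 on [X]. So is D: the weights of the test module are q^(2j) with j
    = 0 or r'', and K^r'' = 1 on [X]. *)
Lemma Rmat_right_odd_vac t u :
    eval (act2 X Y) (R_alpha r alpha) t = u ->
  eval (act2 X Y) (Rmat A) t = eval (act2 X Y) (R_z k p) u.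
Proof.
move=> alpha_u; apply: (@eval_Rmat k p r q alpha X Y _ u u u _ alpha_u) => //.
  move: u {alpha_u}; have Theta1 : eval (act2 X Y) (R_Theta p r q) = \1%VF; last first.
    by move=> u; rewrite Theta1 id_lfunE.
  apply: tprod_ext => x y; rewrite id_lfunE.
  rewrite (eval_R_Theta3 r_div8 q_root) X_E ?zero_lfunE; last first.
    by left; rewrite iterS zero_lfunE.
  by rewrite !tpure0l !scaler0 !addr0.
move: u {alpha_u}; have D1 : eval (act2 X Y) (R_D p r q) = \1%VF; last first.
  by move=> u; rewrite D1 id_lfunE.
apply: tprod_ext => x y; rewrite id_lfunE.
suff : (eval (act2 X Y) (R_D p r q) \o linfun (tpure x) = linfun (tpure x))%VF.
  by move/lfunP/(_ y); rewrite comp_lfunE !lfunE.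
apply: bvec_span => _ [s ->]; rewrite comp_lfunE lfunE /=.
apply: etrans (eval_R_D_right r_div8 q_root _
  (mul_bool_quarter_lt r_div8 q_root (s != None)) (odd_vac_weight s)) _.
by rewrite eval_exp_var; case: (s != None); rewrite ?mul0n // mul1n iter_quarter.
Qed.

Lemma Rmat_left_odd_vac t u :
    eval (act2 Y X) (R_alpha r alpha) t = u ->
  eval (act2 Y X) (Rmat A) t = eval (act2 Y X) (R_z k p) u.
Proof.
move=> alpha_u; apply: (@eval_Rmat k p r q alpha Y X _ u u u _ alpha_u) => //.
  move: u {alpha_u}; have Theta1 : eval (act2 Y X) (R_Theta p r q) = \1%VF; last first.
    by move=> u; rewrite Theta1 id_lfunE.
  apply: tprod_ext => y x; rewrite id_lfunE.
  rewrite (eval_R_Theta3 r_div8 q_root) X_F ?zero_lfunE; last first.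
    by right; rewrite iterS zero_lfunE.
  by rewrite !tpure0r !scaler0 !addr0.
move: u {alpha_u}; have D1 : eval (act2 Y X) (R_D p r q) = \1%VF; last first.
  by move=> u; rewrite D1 id_lfunE.
apply: tprod_ext => y x; rewrite id_lfunE.
suff : (eval (act2 Y X) (R_D p r q) \o linfun (tpure_left x) = linfun (tpure_left x))%VF.
  by move/lfunP/(_ y); rewrite comp_lfunE !lfunE.
apply: bvec_span => _ [s ->]; rewrite comp_lfunE lfunE /= /tpure_left.
apply: etrans (eval_R_D_left r_div8 q_root _
  (mul_bool_quarter_lt r_div8 q_root (s != None)) (odd_vac_weight s)) _.
by rewrite eval_exp_var; case: (s != None); rewrite ?mul0n // mul1n iter_quarter.
Qed.

Lemma odd_vac_L_odd l : act Y gL (odd l) = - odd l.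
Proof. by rewrite odd_vac_L expr1 scaleN1r. Qed.

Lemma odd_vac_Z_vac e' l : act Y (gZ e' l) vac = if e' == e then odd l else 0.
Proof. by rewrite odd_vac_Z andbT. Qed.

Lemma odd_vac_Z_odd e' l m : act Y (gZ e' l) (odd m) = 0.
Proof. by rewrite odd_vac_Z andbF. Qed.

Lemma odd_vac_lin0 (f : 'End(space Y)) : f 0 = 0.
Proof. exact: linear0. Qed.

Lemma odd_vac_linN (f : 'End(space Y)) v : f (- v) = - f v.
Proof. exact: linearN. Qed.

(** [R_alpha] couples opposite signs, so only the generators of sign [~~ e] reach [X]. The minus
    sign is [Lbar] acting on an odd vector. *)
Lemma R_alpha_right_odd_vac x : eval (act2 X Y) (R_alpha r alpha) (tpure x vac) =
  tpure x vac
  - \sum_l ((-1) ^+ e * alpha l) *: tpure (act X (gZ (~~ e) l) x) (odd l).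
Proof.
have LbarZ_vac e' l :
    eval (@Defs.act k A Y) (var k gK ^+ r'' * var k gL * var k (gZ e' l)) vac =
    if e' == e then - odd l else 0.
  rewrite eval_LbarZ iter_quarter; last exact: odd_vac_KK.
  rewrite odd_vac_Z_vac; case: ifP => _; first exact: odd_vac_L_odd.
  exact: odd_vac_lin0.
rewrite eval_R_alpha => [|e1 l1 e2 l2]; last first.
  right; apply: bvec_span => _ [t ->]; rewrite comp_lfunE zero_lfunE.
  rewrite (@eval_LbarZ Y) iter_quarter; last exact: odd_vac_KK.
  rewrite (@eval_LbarZ Y) iter_quarter; last exact: odd_vac_KK.
  rewrite odd_vac_Z; case: ifP => _; last by rewrite !odd_vac_lin0.
  by rewrite odd_vac_L_odd odd_vac_linN odd_vac_Z_odd oppr0 odd_vac_lin0.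
rewrite add_lfunE id_lfunE sum_lfunE (sum_bool_pair (b := ~~ e)) => [|l].
  rewrite -sumrN; congr (_ + _); apply: eq_bigr => l _.
  by rewrite scale_lfunE tmapE LbarZ_vac /fst /snd negbK eqxx tpureNr scalerN.
rewrite scale_lfunE tmapE LbarZ_vac /fst /snd negbK.
by case: ifP => [|_]; [case: (e) | rewrite tpure0r scaler0].
Qed.

Lemma R_alpha_left_vac y : eval (act2 Y X) (R_alpha r alpha) (tpure vac y) =
  tpure vac y
  + \sum_l ((-1) ^+ (~~ e) * alpha l) *:
      tpure (odd l) (act X gL (act X (gZ (~~ e) l) y)).
Proof.
rewrite eval_R_alpha => [|*]; last by left; exact: odd_vac_ZZ.
rewrite add_lfunE id_lfunE sum_lfunE (sum_bool_pair (b := e)) => [|l].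
  congr (_ + _); apply: eq_bigr => l _.
  by rewrite scale_lfunE tmapE eval_LbarZ iter_quarter // odd_vac_Z_vac /fst eqxx.
rewrite scale_lfunE tmapE odd_vac_Z_vac /fst.
by case: ifP => [|_]; [case: (e) | rewrite tpure0l scaler0].
Qed.

Lemma R_alpha_left_odd l y :
  eval (act2 Y X) (R_alpha r alpha) (tpure (odd l) y) = tpure (odd l) y.
Proof.
rewrite eval_R_alpha => [|*]; last by left; exact: odd_vac_ZZ.
rewrite add_lfunE id_lfunE sum_lfunE big1 ?addr0 // => i _.
by rewrite scale_lfunE tmapE odd_vac_Z_odd tpure0l scaler0.
Qed.

Lemma braid_vac x : rep_braid X Y (tpure x vac) = tpure vac x
  - \sum_l ((-1) ^+ e * alpha l) *: tpure (odd l) (act X gL (act X (gZ (~~ e) l) x)).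
Proof.
apply: etrans (comp_lfunE _ _ _) _.
rewrite (Rmat_right_odd_vac (R_alpha_right_odd_vac x)).
have Rz t x' : eval (act2 X Y) (R_z k p) (tpure x' (bvec k t)) =
    tpure (iter (t != None) (act X gL) x') (bvec k t).
  by rewrite (eval_R_z_right r_div8 q_root _ (odd_vac_L r q alpha e t)).
rewrite linearB linear_sum /= Rz linearB linear_sum /= tflipE; congr (_ - _).
apply: eq_bigr => l _; apply: etrans (congr1 _ (linearZ _ _)) _.
by rewrite /= Rz linearZ /= tflipE.
Qed.

(** The L applied by [R_z] cancels the one in [Lbar], so none is left, in contrast to
    [braid_vac]. *)
Lemma braid_vac' y : rep_braid Y X (tpure vac y) = tpure y vac
  + \sum_l ((-1) ^+ (~~ e) * alpha l) *: tpure (act X (gZ (~~ e) l) y) (odd l).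
Proof.
apply: etrans (comp_lfunE _ _ _) _.
rewrite (Rmat_left_odd_vac (R_alpha_left_vac y)).
have Rz t x' : eval (act2 Y X) (R_z k p) (tpure (bvec k t) x') =
    tpure (bvec k t) (iter (t != None) (act X gL) x').
  by rewrite (eval_R_z_left r_div8 q_root _ (odd_vac_L r q alpha e t)).
rewrite linearD linear_sum /= Rz linearD linear_sum /= tflipE; congr (_ + _).
apply: eq_bigr => l _; apply: etrans (congr1 _ (linearZ _ _)) _.
rewrite /= Rz linearZ /= tflipE -[act X gL (act X gL _)]comp_lfunE X_LL.
by rewrite id_lfunE.
Qed.

Lemma braid_odd' l y : rep_braid Y X (tpure (odd l) y) = tpure (act X gL y) (odd l).
Proof.
apply: etrans (comp_lfunE _ _ _) _.
rewrite (Rmat_left_odd_vac (R_alpha_left_odd l y)).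
by rewrite (eval_R_z_left r_div8 q_root _ (odd_vac_L r q alpha e (Some l))) tflipE.
Qed.

(** In the double braiding of x ⊗ [vac], each of the two braidings contributes -(-1)^e alpha_l Z x
    as coefficient of [odd l]. The total is twice this and must vanish, while 2 alpha_l is
    invertible. *)
Lemma odd_vac_Z0 l : alpha l != 0 -> act X (gZ (~~ e) l) = 0.
Proof.
move=> alpha_l; apply/lfunP=> x; rewrite zero_lfunE.
have : rep_braid Y X (rep_braid X Y (tpure x vac)) = tpure x vac.
  by apply: etrans (esym (comp_lfunE _ _ _)) _; rewrite XY_trivial id_lfunE.
rewrite braid_vac linearB linear_sum /= braid_vac'.
under [X in _ - X]eq_bigr do rewrite linearZ /= braid_odd'
  -[act X gL (act X gL _)]comp_lfunE X_LL id_lfunE.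
rewrite -addrA -sumrB => /eqP; rewrite -subr_eq0 [tpure x vac + _]addrC addrK => /eqP.
move/(congr1 (slice (space X) (Some l))); rewrite linear_sum linear0 /= (bigD1 l) //=.
rewrite big1 => [|m neq_ml]; last first.
  have neq_lm : (Some l == Some m) = false.
    by apply: contraNF neq_ml => /eqP[->].
  by rewrite -scalerBl linearZ /= slice_bvec neq_lm scaler0.
rewrite addr0 -scalerBl linearZ /= slice_bvec eqxx -mulrBl => /eqP.
rewrite scaler_eq0 mulf_eq0 (negPf alpha_l) orbF => /orP[|/eqP//].
have two := two_neq0 r_div8 q_root.
case: (e); rewrite /= ?expr0 ?expr1 ?opprK => sgn0; case/negP: two => //.
by rewrite -oppr_eq0 mulr2n opprD.
Qed.

End OddVac.

End Detection.

(** * The centre and the inflation functor *)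

Section MugerCentre.
Variables (k : fieldType) (p r : nat) (q : k) (alpha : 'I_p -> k).
Hypotheses (r_div8 : (8 %| r)%N) (q_root : r.-primitive_root q).
Hypothesis alpha_neq0 : forall l, alpha l != 0.

Local Notation A := (A_alg r q alpha).
Local Notation B := (Sp_alg k p).
Local Notation A_mod := (modcat A).
Local Notation B_mod := (modcat B).

Lemma transparent_central (X : rep A) :
  is_module X -> transparent (C := A_mod) X -> central X.
Proof.
move=> Xm Xt.
have t3 : (rep_braid (triplet r q alpha) X \o rep_braid X (triplet r q alpha) = \1)%VF.
  exact: (Xt (triplet r q alpha) (triplet_module r_div8 q_root)).
have tv e :
    (rep_braid (odd_vac r q alpha e) X \o rep_braid X (odd_vac r q alpha e) = \1)%VF.
  exact: (Xt (odd_vac r q alpha e) (odd_vac_module r_div8 q_root e)).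
have E0 := triplet_E0 r_div8 q_root Xm t3.
have F0 := triplet_F0 r_div8 q_root Xm t3.
have KK : (act X gK \o act X gK = \1)%VF.
  apply/lfunP=> v; rewrite comp_lfunE id_lfunE.
  exact: (triplet_KK r_div8 q_root Xm t3).
split=> //.
(* A test module detects the generators of the opposite sign, so [gZ e l] is treated with
   [odd_vac (~~ e)]. *)
- move=> e l; rewrite -[e]negbK.
  exact: (odd_vac_Z0 r_div8 q_root E0 F0 KK (module_LL Xm) (tv (~~ e)) (alpha_neq0 l)).
- exact: module_LL.
- by rewrite (module_rel2 Xm (A_LK _ _ _)).
- exact: module_S1.
- exact: module_SS.
- by move=> s; rewrite (module_rel2 Xm (A_SK _ _ s)).
- by move=> s; rewrite (module_rel2 Xm (A_SL _ _ s)).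
Qed.

Local Notation in_centre := (fun X : rep A => is_module X /\ transparent (C := A_mod) X).

(** Replaces a condition against all modules by finitely many identities, for which closure under
    tensor products is a computation. *)
Lemma centreE (X : rep A) : in_centre X <-> central X.
Proof.
split=> [[]|Xc]; first exact: transparent_central.
by split; [exact: central_module | exact: central_transparent].
Qed.

Lemma centre_super : @super_class k A gL in_centre.
Proof.
have [one tens counit coprod invol comm Rmat] := central_super alpha r_div8 q_root.
split.
- exact/centreE.
- by move=> X Y /centreE Xc /centreE Yc; apply/centreE; exact: tens.
- by move=> X x /centreE; exact: counit.
- by move=> X Y x /centreE Xc /centreE Yc; exact: coprod.
- by move=> X /centreE; exact: invol.
- by move=> X x /centreE; exact: comm.
- by move=> X Y /centreE Xc /centreE Yc; exact: Rmat.
Qed.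

Lemma muger_centre_symmetric : is_symmetric (muger_centre A_mod).
Proof. exact: super_symmetric (two_neq0 r_div8 q_root) centre_super. Qed.

Lemma Sp_moduleP (X : rep B) : is_module X <->
  act X 1%g = \1%VF /\
  forall s t : 'S_p, (act X s \o act X t = act X (t * s)%g)%VF.
Proof.
have ev2 (s t : 'S_p) :
    eval (@Defs.act k B X) (var k s * var k t) = (act X s \o act X t)%VF.
  by apply: etrans (evalM _ _ _) _; rewrite !eval_var.
split=> [Xm|[X1 XM] a b].
  split=> [|s t]; first by rewrite -eval_var (Xm _ _ (Sp_one _ _)) eval1.
  by rewrite -ev2 (Xm _ _ (Sp_mul _ s t)) eval_var.
by case=> [|s t]; [rewrite eval_var eval1 | rewrite ev2 eval_var].
Qed.

Lemma Sp_coprod (X Y : rep B) (s : 'S_p) :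
  eval (act2 X Y) (pure2 (var k s) (var k s)) = tmap (act X s) (act Y s).
Proof. by apply: etrans (eval_pure2 _ _ _ _) _; rewrite !eval_var. Qed.

Lemma Rmat_parity1 (U V : vectType k) : (2%:R^-1 *:
  (tmap \1 \1 + tmap \1 \1 + tmap \1 \1 - tmap \1 \1) = \1 :> 'End(tprod U V))%VF.
Proof.
rewrite addrK tmap1 -mulr2n -scaler_nat scalerA mulVf ?scale1r //.
exact: two_neq0 r_div8 q_root.
Qed.

(** The identity permutation serves as parity: every vector is even, and the sign rule becomes the
    R-matrix 1. *)
Lemma Sp_super : @super_class k B 1%g (@is_module k B).
Proof.
split.
- by apply/Sp_moduleP; split=> [|s t] /=; rewrite !scale1r ?comp_lfun1l.
- move=> X Y /Sp_moduleP[X1 XM] /Sp_moduleP[Y1 YM]; apply/Sp_moduleP.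
  have cp (s : 'S_p) : act (rep_tens X Y) s = tmap (act X s) (act Y s).
    exact: Sp_coprod.
  split=> [|s t]; rewrite !cp; first by rewrite X1 Y1 tmap1.
  by rewrite -tmap_comp XM YM.
- by move=> X s _; rewrite /= scale1r.
- by move=> X Y s _ _; exact: Sp_coprod.
- by move=> X /Sp_moduleP[-> _]; rewrite comp_lfun1l.
- by move=> X s /Sp_moduleP[-> _]; rewrite comp_lfun1l comp_lfun1r.
- move=> X Y /Sp_moduleP[-> _] /Sp_moduleP[-> _].
  by rewrite Rmat_parity1; exact: eval1.
Qed.

Lemma Sp_symmetric : is_symmetric B_mod.
Proof. exact: super_symmetric (two_neq0 r_div8 q_root) Sp_super. Qed.

Definition inflate (X : rep B) : rep A := @Rep k A (space X)
  (fun x => match x with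
            | gK | gL => \1%VF
            | gE | gF | gZ _ _ => 0
            | gS s => act X s
            end).

Lemma inflate_central (X : rep B) : is_module X -> central (inflate X).
Proof. by case/Sp_moduleP=> X1 XM; split=> *; rewrite /= ?comp_lfun1l ?comp_lfun1r. Qed.

Lemma inflate_in_centre (X : rep B) : is_module X -> in_centre (inflate X).
Proof. by move/inflate_central/centreE. Qed.

Lemma inflate_hom (X Y : rep B) (f : 'Hom(space X, space Y)) :
  is_module_hom f -> @is_module_hom k A (inflate X) (inflate Y) f.
Proof.
by move=> fh [||||e l|s] /=;
  rewrite ?comp_lfun1l ?comp_lfun1r ?comp_lfun0l ?comp_lfun0r ?fh.
Qed.

(** Both modules live on the same space, so this equality of operators lets identity maps serve as
    the monoidal structure of [inflation]. *)
Lemma inflate_tens (X Y : rep B) x : is_module X -> is_module Y ->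
  act (rep_tens (inflate X) (inflate Y)) x = act (inflate (rep_tens X Y)) x.
Proof.
move=> Xm Ym; rewrite [LHS](central_coprod _ (inflate_central Xm) (inflate_central Ym)).
case: x => [||||e l|s]; rewrite /= ?tmap1 ?tmap0l //.
exact: esym (Sp_coprod X Y s).
Qed.

Definition inflation : mfunctor B_mod (muger_centre A_mod) :=
  @MFunctor B_mod (muger_centre A_mod) inflate (fun X Y f => f)
    (\1%VF : 'End(k^o)) (fun X Y => \1%VF : 'End(tprod (space X) (space Y))).

Lemma inflation_braided : is_braided_functor inflation.
Proof.
split; last first.
  move=> X Y Xm Ym; apply: etrans (comp_lfun1l _) _; apply: esym.
  apply: etrans (comp_lfun1r _) _; congr comp_lfun.
  apply: etrans (eval1 _) _; apply: esym.
  apply: etrans (central_Rmat r_div8 q_root (inflate_central Xm) (inflate_central Ym)) _.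
  exact: Rmat_parity1.
split.
- split=> //.
  + exact: inflate_in_centre.
  + by move=> X Y f _ _; exact: inflate_hom.
- split; first by case=> [||||e l|s]; rewrite /= ?comp_lfun1l ?comp_lfun1r ?scale1r ?scale0r.
  exists (\1%VF : 'End(k^o)); split; try exact: comp_lfun1l.
  by case=> [||||e l|s]; rewrite /= ?comp_lfun1l ?comp_lfun1r ?scale1r ?scale0r.
- move=> X Y Xm Ym; split.
    move=> x; rewrite (inflate_tens x Xm Ym).
    by apply: etrans (comp_lfun1l _) (esym (comp_lfun1r _)).
  exists (\1%VF : 'End(tprod (space X) (space Y))); split; try exact: comp_lfun1l.
  move=> x; rewrite (inflate_tens x Xm Ym).
  by apply: etrans (comp_lfun1l _) (esym (comp_lfun1r _)).
- by move=> X X' Y Y' f g *; apply: etrans (comp_lfun1l _) (esym (comp_lfun1r _)).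
- by move=> X Y Z *; rewrite /= !tmap1 !comp_lfun1l !comp_lfun1r.
- by move=> X *; rewrite /= !tmap1 !comp_lfun1r.
- by move=> X *; rewrite /= !tmap1 !comp_lfun1r.
Qed.

Lemma inflation_fully_faithful : fully_faithful inflation.
Proof.
move=> X Y Xm Ym; split=> // g gh; exists g => // s.
exact: (gh (gS s)).
Qed.

End MugerCentre.

(** * Failure of semisimplicity *)

Section NonSemisimple.
Variables (k : fieldType) (p r : nat) (q : k) (alpha : 'I_p -> k).
Hypotheses (r_div8 : (8 %| r)%N) (q_root : r.-primitive_root q).
Hypothesis alpha_neq0 : forall l, alpha l != 0.
Hypothesis char_k : p \in [pchar k].

Local Notation A := (A_alg r q alpha).
Local Notation V := {ffun 'I_p -> k^o}.

Definition perm_Sp : rep (Sp_alg k p) :=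
  @Rep k (Sp_alg k p) V (fun s : 'S_p => bop (fun l => bvec k (s l))).

Lemma perm_Sp_module : is_module perm_Sp.
Proof.
have SE (s : 'S_p) l : act perm_Sp s (bvec k l) = bvec k (s l) by exact: bopE.
apply/Sp_moduleP; split=> [|s t].
  by apply: bvec_span => _ [l ->]; rewrite SE perm1 id_lfunE.
by apply: bvec_span => _ [l ->]; rewrite comp_lfunE !SE permM.
Qed.

Definition perm_A : rep A := inflate r q alpha perm_Sp.

Definition all_ones : V := \sum_l bvec k l.

Definition const_vec (c : k^o) : V := c *: all_ones.

Lemma const_vec_is_linear : linear const_vec.
Proof. by move=> c x y; rewrite /const_vec scalerDl scalerA. Qed.

HB.instance Definition _ :=
  GRing.isLinear.Build k k^o V _ const_vec const_vec_is_linear.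

Lemma perm_A_S (s : 'S_p) l : act perm_A (gS s) (bvec k l) = bvec k (s l).
Proof. exact: bopE. Qed.

Lemma const_vec_hom : @is_module_hom k A (rep_one A) perm_A (linfun const_vec).
Proof.
have cE c : linfun const_vec c = const_vec c by rewrite lfunE.
move=> x; apply/lfunP=> c; rewrite comp_lfunE [RHS]comp_lfunE !cE.
case: x => [||||e l|s]; rewrite /= ?scale1r ?scale0r ?id_lfunE ?zero_lfunE ?linear0 //.
rewrite linearZ linear_sum /=; congr (_ *: _).
rewrite /all_ones (reindex_inj (@perm_inj _ s)); apply: eq_bigr => l _.
by rewrite bopE.
Qed.

(* Every equivariant functional is constant on the basis, hence vanishes on the
   sum of its [p] vectors. *)
Lemma equivariant_functional0 (phi : 'Hom(space perm_A, k^o)) :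
  @is_module_hom k A perm_A (rep_one A) phi -> phi all_ones = 0.
Proof.
move=> phi_hom; have p_gt0 : (0 < p)%N by exact: prime_gt0 (pcharf_prime char_k).
pose l0 := Ordinal p_gt0.
have phiE l : phi (bvec k l) = phi (bvec k l0).
  have /lfunP/(_ (bvec k l0)) := phi_hom (gS (tperm l0 l)).
  by rewrite !comp_lfunE perm_A_S tpermL /= scale1r id_lfunE.
rewrite linear_sum /= (eq_bigr _ (fun l _ => phiE l)) sumr_const card_ord.
by rewrite -scaler_nat (pcharf0 char_k) scale0r.
Qed.

Lemma muger_centre_not_semisimple : ~ semisimple (muger_centre (modcat A)).
Proof.
have permC : is_ob (perm_A : ob (muger_centre (modcat A))).
  have := inflate_in_centre r_div8 q_root alpha_neq0.
  by move=> /(_ perm_Sp); apply; exact: perm_Sp_module.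
have oneC : is_ob (rep_one A : ob (muger_centre (modcat A))).
  exact: super_one (centre_super r_div8 q_root alpha_neq0).
move=> /(_ _ permC)[n [S [S_simple [inj [prj [ip_hom _ _ ip_sum]]]]]].
have p_gt0 : (0 < p)%N by exact: prime_gt0 (pcharf_prime char_k).
have ones_neq0 : all_ones != 0.
  apply/eqP=> /ffunP/(_ (Ordinal p_gt0)); rewrite sum_ffunE ffunE.
  rewrite (bigD1 (Ordinal p_gt0)) //= ffunE eqxx big1 => [/eqP|l neq_l].
    by rewrite addr0 oner_eq0.
  by rewrite ffunE eq_sym (negPf neq_l).
(* The sum of the [inj i ∘ prj i] is the identity, so not all projections can kill [all_ones]. *)
have [i prj_i] : exists i, (prj i : 'Hom(space perm_A, space (S i))) all_ones != 0.
  apply/existsP; apply: contraNT ones_neq0 => /existsPn prj0.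
  have /lfunP/(_ all_ones) : (\sum_(i < n) ((inj i : 'Hom(space (S i), space perm_A))
      \o (prj i : 'Hom(space perm_A, space (S i)))) = \1)%VF by exact: ip_sum.
  rewrite id_lfunE sum_lfunE => <-; rewrite big1 // => i _.
  by rewrite comp_lfunE (eqP (negbNE (prj0 i))) linear0.
pose f : 'Hom(space (rep_one A), space (S i)) :=
  ((prj i : 'Hom(space perm_A, space (S i))) \o linfun const_vec)%VF.
have f_hom : is_module_hom f.
  by move=> x; rewrite -comp_lfunA const_vec_hom comp_lfunA (proj2 (ip_hom i) x) -comp_lfunA.
have fE c : f c = (c : k) *: f (1 : k^o).
  by rewrite -linearZ; congr (f _); exact: esym (mulr1 _).
have f1 : f (1 : k^o) = (prj i : 'Hom(space perm_A, space (S i))) all_ones.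
  by rewrite comp_lfunE lfunE /= /const_vec scale1r.
(* The source is one-dimensional and f c = c f(1) with f(1) nonzero, so [f] is injective. *)
have f_mono : @mono (muger_centre (modcat A)) (rep_one A) (S i) f.
  split=> // W g g' _ _ _ fg; apply/lfunP=> v.
  have : f (g v) = f (g' v) by rewrite -!comp_lfunE; congr (fun_of_lfun _ v); exact: fg.
  rewrite (fE (g v)) (fE (g' v)) f1 => /eqP; rewrite -subr_eq0 -scalerBl scaler_eq0.
  by rewrite (negPf prj_i) orbF subr_eq0 => /eqP.
have [_ _ S_min] := S_simple i.
(* The unit object is not zero, so simplicity makes [f] invertible; [g] composed with [prj i] is
   then an equivariant functional with value 1 on [all_ones]. *)
case: (S_min _ _ oneC f_mono) => [[_ id0]|[_ [g [g_hom gf _]]]].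
  have /lfunP/(_ 1) : \1%VF = 0 :> 'End(k^o) by exact: id0.
  by rewrite id_lfunE zero_lfunE => /eqP; rewrite oner_eq0.
pose phi : 'Hom(space perm_A, k^o) :=
  ((g : 'Hom(space (S i), k^o)) \o (prj i : 'Hom(space perm_A, space (S i))))%VF.
have phi_hom : @is_module_hom k A perm_A (rep_one A) phi.
  by move=> x; rewrite -comp_lfunA (proj2 (ip_hom i) x) comp_lfunA (g_hom x) -comp_lfunA.
have /lfunP/(_ 1) : ((g : 'Hom(space (S i), k^o)) \o f = \1)%VF by exact: gf.
rewrite comp_lfunE f1 id_lfunE -comp_lfunE (equivariant_functional0 phi_hom) => /eqP.
by rewrite eq_sym oner_eq0.
Qed.

End NonSemisimple.

Theorem proposition7p16 (k : closedFieldType) (p r : nat) (q : k)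
    (alpha : 'I_p -> k)
    (p_prime : prime p) (p_gt2 : (2 < p)%N) (char_k : p \in [pchar k])
    (r_div8 : (8 %| r)%N) (r_coprime : coprime r p)
    (q_root : r.-primitive_root q)
    (alpha_neq0 : forall l, alpha l != 0) :
  let A_mod := modcat (A_alg r q alpha) in
  let Sp_mod := modcat (Sp_alg k p) in
  [/\ exists I : mfunctor Sp_mod (muger_centre A_mod), symmetric_embedding I,
      is_symmetric (muger_centre A_mod)
    & ~ semisimple (muger_centre A_mod)].
Proof.
move=> A_mod Sp_mod; have centre_sym := muger_centre_symmetric r_div8 q_root alpha_neq0.
split=> //; last exact: muger_centre_not_semisimple.
exists (inflation r q alpha); split=> //.
- exact: Sp_symmetric r_div8 q_root.
- exact: inflation_braided.
- exact: inflation_fully_faithful.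
Qed.
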